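(* Let $(\bar x,\bar y,\bar u,\bar w)$ be a local optimal solution to (GCP). (a) Suppose that $V$ is Lipschitz continuous near $\bar x$ and that (GCP) is Clarke calm at $(\bar x,\bar y,\bar u,\bar w)$. Then $(\bar x,\bar y,\bar u,\bar w)$ is an M-stationary point based on the value function. (b) Suppose that (GCP) is partially calm at $(\bar x,\bar y,\bar u,\bar w)$ with penalty parameter $\mu$, that either $\mu=0$ or the value function $V$ is smooth (continuously differentiable near $\bar x$), and that MPEC LICQ holds at $(\bar x,\bar y,\bar u,\bar w)$. Then $(\bar x,\bar y,\bar u,\bar w)$ is an S-stationary point based on the value function.
   Context: $F:\mathbb{R}^n\times\mathbb{R}^m\to\mathbb{R}$ is continuously differentiable; $f:\mathbb{R}^n\times\mathbb{R}^m\to\mathbb{R}$ and $g:\mathbb{R}^n\times\mathbb{R}^m\to\mathbb{R}^p$ are three times continuously differentiable; $H_2:\mathbb{R}^n\times\mathbb{R}^m\times\mathbb{R}^p\times\mathbb{R}^l\to\mathbb{R}^s$ is continuously differentiable, and $C\subseteq\mathbb{R}^s$ is nonempty and convex. $V(x):=\inf_y\{f(x,y): g(x,y)\le 0\}$. $H_1(x,y,u):=\nabla_y f(x,y)+\sum_{i=1}^p u_i\nabla_y g_i(x,y)\in\mathbb{R}^m$. $\partial^c V$ is the Clarke generalized gradient, $N_C$ the normal cone of convex analysis, $e_j$ the $j$-th unit vector of $\mathbb{R}^p$, $Dh$ the Jacobian of a map $h$, $\operatorname{dist}$ the Euclidean distance, $B(z,\epsilon)$ the open ball of radius $\epsilon$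 about $z$. (GCP): minimize $F(x,y)$ over $(x,y,u,w)$ subject to $f(x,y)-V(x)\le 0$, $g(x,y)\le 0$, $u\ge 0$, $u^Tg(x,y)=0$, $H_1(x,y,u)=0$, $H_2(x,y,u,w)\in C$. (GCP$_\mu$): minimize $F(x,y)+\mu(f(x,y)-V(x))$ over $(x,y,u,w)$ subject to $g(x,y)\le 0$, $u\ge 0$, $u^Tg(x,y)=0$, $H_1(x,y,u)=0$, $H_2(x,y,u,w)\in C$. Partial calmness of (GCP) at a local solution, with penalty parameter $\mu\ge 0$: the point is a local solution of (GCP$_\mu$). (GCP) is partially calm if this holds for some $\mu\ge0$. Clarke calmness: let $\Omega^p_{CS}:=\{(a,b)\in\mathbb{R}^p\times\mathbb{R}^p: a\le 0,\ b\le 0,\ \langle a,b\rangle=0\}$ and, for $(r_1,r_2,r_3,P_1,P_2)\in\mathbb{R}\times\mathbb{R}^p\times\mathbb{R}^p\times\mathbb{R}^m\times\mathbb{R}^s$, let $\mathcal{F}(r_1,r_2,r_3,P_1,P_2)$ be the set of $(x,y,u,w)$ with $f(x,y)-V(x)+r_1\le 0$, $(g(x,y)-r_2,-u+r_3)\in\Omega^p_{CS}$, $H_1(x,y,u)+P_1=0$, $H_2(x,y,u,w)+P_2\in C$. (GCP) is Clarke calm at a local optimal solution $(\bar x,\bar y,\bar u,\bar w)$ if there exist $\epsilon>0$ and $\mu\ge 0$ such that for all $(r_1,r_2,r_3,P_1,P_2)\in B(0,\epsilon)$ and all $(x,y,u,w)\in B((\bar x,\bar y,\bar u,\bar w),\epsilon)\cap\mathcal{F}(r_1,r_2,r_3,P_1,P_2)$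 one has $F(x,y)-F(\bar x,\bar y)+\mu\|(r_1,r_2,r_3,P_1,P_2)\|\ge 0$. Index sets at $(\bar x,\bar y,\bar u,\bar w)$: $I_g:=\{j: g_j(\bar x,\bar y)=0,\bar u_j>0\}$, $I_u:=\{j: g_j(\bar x,\bar y)<0,\bar u_j=0\}$, $I_0:=\{j: g_j(\bar x,\bar y)=0,\bar u_j=0\}$, $J_0(\bar x,\bar y):=\{j: g_j(\bar x,\bar y)=0\}=I_g\cup I_0$. M-stationarity based on the value function: a feasible point $(\bar x,\bar y,\bar u,\bar w)$ of (GCP) such that there exist $\mu\ge 0$, $\lambda^g,\lambda^u\in\mathbb{R}^p$, $\lambda_1^H\in\mathbb{R}^m$, $\lambda_2^H\in\mathbb{R}^s$ with (i) $0\in\big[\nabla F(\bar x,\bar y)+\mu\big(\nabla f(\bar x,\bar y)-\partial^cV(\bar x)\times\{0\}\big)+Dg(\bar x,\bar y)^T\lambda^g\big]\times\{(0,0)\}-(0,0,\lambda^u,0)+\big(DH_1(\bar x,\bar y,\bar u)^T\lambda_1^H,\,0\big)+DH_2(\bar x,\bar y,\bar u,\bar w)^T\lambda_2^H$ in $\mathbb{R}^n\times\mathbb{R}^m\times\mathbb{R}^p\times\mathbb{R}^l$ (if $\mu=0$, the term multiplied by $\mu$ is zero); (ii) $\lambda_j^g=0$ for $j\in I_u$, $\lambda_j^u=0$ for $j\in I_g$, $\lambda_2^H\in N_C(H_2(\bar x,\bar y,\bar u,\bar w))$; (iii) for every $j\in I_0$, either $\lambda_j^g>0$ and $\lambda_j^u>0$,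 or $\lambda_j^g\lambda_j^u=0$. S-stationarity based on the value function: same, with (iii) replaced by $\lambda_j^g\ge 0$ and $\lambda_j^u\ge 0$ for all $j\in I_0$. MPEC LICQ at a point $(\bar x,\bar y,\bar u,\bar w)$ feasible for (GCP$_\mu$): whenever scalars $\lambda^g_j$ ($j\in J_0(\bar x,\bar y)$), $\lambda^u_j$ ($j\in I_u\cup I_0$) and vectors $\lambda_1^H\in\mathbb{R}^m$, $\lambda_2^H\in\mathbb{R}^s$ satisfy $$0=\sum_{j\in J_0(\bar x,\bar y)}\lambda_j^g\,(\nabla g_j(\bar x,\bar y),0,0)-\Big(0,0,\sum_{j\in I_u\cup I_0}\lambda_j^u e_j,0\Big)+\big(DH_1(\bar x,\bar y,\bar u)^T\lambda_1^H,0\big)+DH_2(\bar x,\bar y,\bar u,\bar w)^T\lambda_2^H$$ and $\lambda_2^H\in\operatorname{span}N_C(H_2(\bar x,\bar y,\bar u,\bar w))$, then all $\lambda^g_j$, $\lambda^u_j$, $\lambda_1^H$, $\lambda_2^H$ vanish. Here $\operatorname{span}$ denotes the affine hull. *)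

(* Defs.v *)
From HB Require Import structures.
From mathcomp Require Import all_boot all_order all_algebra.
From mathcomp Require Import all_classical all_reals all_analysis.
Set Implicit Arguments.
Unset Strict Implicit.
Unset Printing Implicit Defensive.
Import Order.TTheory GRing.Theory Num.Theory.
Import numFieldNormedType.Exports.
Local Open Scope classical_set_scope.
Local Open Scope ring_scope.

(* Vectors are row vectors, and a product R^n x R^m is represented by
   'rV_(n + m) through row_mx.  The canonical norm of 'rV_n is the max norm,
   so the Euclidean norm is introduced separately. *)

Section general.
Context {R : realType}.

Definition dotp {n} (a b : 'rV[R]_n) : R := \sum_(i < n) a 0 i * b 0 i.

Definition enorm {n} (a : 'rV[R]_n) : R := Num.sqrt (dotp a a).

(* k times continuously differentiable on the whole space: differentiable,
   with every directional derivative of class C^(k-1). *)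
Fixpoint Ck {U W : normedModType R} (k : nat) (h : U -> W) : Prop :=
  if k is k'.+1 then
    (forall z, differentiable h z) /\ (forall v, Ck k' (fun z => 'D_v h z))
  else continuous h.

Definition grad {n} (h : 'rV[R]_n -> R) (z : 'rV[R]_n) : 'rV[R]_n :=
  \row_i 'D_(delta_mx 0 i) h z.

(* The usual k x n Jacobian; 'J is its transpose since 'J acts on row vectors
   from the right.  Hence (Dh)^T lambda is the row vector lambda *m Dmx h z. *)
Definition Dmx {n k} (h : 'rV[R]_n -> 'rV[R]_k) (z : 'rV[R]_n) : 'M[R]_(k, n) :=
  ('J h z)^T.

(* An extended-real function that is finite and Lipschitz around x. *)
Definition lipschitz_near {n} (phi : 'rV[R]_n -> \bar R) (x : 'rV[R]_n) : Prop :=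
  exists A : set 'rV[R]_n, [/\ nbhs x A,
    forall z, A z -> phi z \is a fin_num
    & [lipschitz fine (phi z) | z in A]].

Definition C1_near {n} (phi : 'rV[R]_n -> \bar R) (x : 'rV[R]_n) : Prop :=
  \forall z \near x, [/\ phi z \is a fin_num,
    differentiable (fine \o phi) z
    & forall v, {for z, continuous (fun z' => 'D_v (fine \o phi) z')}].

(* Clarke's generalized directional derivative: the limsup of
   (h (z + t v) - h z) / t as z tends to x and t decreases to 0. *)
Definition clarke_dd {n} (h : 'rV[R]_n -> R) (x v : 'rV[R]_n) : \bar R :=
  limf_esup (fun q : 'rV[R]_n * R => ((h (q.1 + q.2 *: v) - h q.1) / q.2)%:E)
            (filter_prod (nbhs x) (0 : R)^'+).

(* Only meant for functions that are Lipschitz near x; empty otherwise. *)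
Definition clarke_grad {n} (phi : 'rV[R]_n -> \bar R) (x : 'rV[R]_n) :
    set 'rV[R]_n :=
  [set xi | lipschitz_near phi x /\
    forall v, ((dotp xi v)%:E <= clarke_dd (fine \o phi) x v)%E].

Definition normal_cone {s} (C : set 'rV[R]_s) (z : 'rV[R]_s) : set 'rV[R]_s :=
  [set v | C z /\ forall c, C c -> dotp v (c - z) <= 0].

Definition affine_hull {s} (S : set 'rV[R]_s) : set 'rV[R]_s :=
  [set z | exists k (a : 'I_k -> R) (v : 'I_k -> 'rV[R]_s),
    [/\ forall i, S (v i), \sum_i a i = 1 & z = \sum_i a i *: v i]].

End general.

Section gcp.
Context {R : realType} {n m p l s : nat}.
Variables (F f : 'rV[R]_(n + m) -> R) (g : 'rV[R]_(n + m) -> 'rV[R]_p).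
Variables (H2 : 'rV[R]_(n + m + p + l) -> 'rV[R]_s) (C : set 'rV[R]_s).
Implicit Types (x : 'rV[R]_n) (y : 'rV[R]_m) (u : 'rV[R]_p) (w : 'rV[R]_l).

Definition triple x y u : 'rV[R]_(n + m + p) := row_mx (row_mx x y) u.

Definition quad x y u w : 'rV[R]_(n + m + p + l) := row_mx (triple x y u) w.

Definition value x : \bar R :=
  ereal_inf [set (f (row_mx x y))%:E |
              y in [set y | forall j, g (row_mx x y) 0 j <= 0]].

Definition grad_y (h : 'rV[R]_(n + m) -> R) (z : 'rV[R]_(n + m)) : 'rV[R]_m :=
  rsubmx (grad h z).

Definition H1 (t : 'rV[R]_(n + m + p)) : 'rV[R]_m :=
  grad_y f (lsubmx t) +
  \sum_(i < p) rsubmx t 0 i *: grad_y (fun z => g z 0 i) (lsubmx t).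

Definition feasible_GCPmu x y u w : Prop :=
  [/\ forall j, g (row_mx x y) 0 j <= 0,
      forall j, 0 <= u 0 j,
      dotp u (g (row_mx x y)) = 0,
      H1 (triple x y u) = 0
    & C (H2 (quad x y u w))].

Definition feasible_GCP x y u w : Prop :=
  ((f (row_mx x y))%:E - value x <= 0)%E /\ feasible_GCPmu x y u w.

Definition local_solution (feasible : 'rV[R]_n -> 'rV[R]_m -> 'rV[R]_p ->
    'rV[R]_l -> Prop) (obj : 'rV[R]_n -> 'rV[R]_m -> \bar R) x0 y0 u0 w0 : Prop :=
  feasible x0 y0 u0 w0 /\
  exists2 eps : R, 0 < eps &
    forall x y u w, enorm (quad x y u w - quad x0 y0 u0 w0) < eps ->
      feasible x y u w -> (obj x0 y0 <= obj x y)%E.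

Definition local_solution_GCP :=
  local_solution feasible_GCP (fun x y => (F (row_mx x y))%:E).

(* For mu = 0 the penalty term vanishes even where value x is infinite
   (0 * +oo = 0 in \bar R). *)
Definition local_solution_GCPmu (mu : R) :=
  local_solution feasible_GCPmu (fun x y =>
    ((F (row_mx x y))%:E + mu%:E * ((f (row_mx x y))%:E - value x))%E).

Definition partially_calm_with (mu : R) x0 y0 u0 w0 : Prop :=
  0 <= mu /\ local_solution_GCPmu mu x0 y0 u0 w0.

Definition OmegaCS (a b : 'rV[R]_p) : Prop :=
  [/\ forall j, a 0 j <= 0, forall j, b 0 j <= 0 & dotp a b = 0].

Definition perturbed_feasible (r1 : R) (r2 r3 : 'rV[R]_p) (P1 : 'rV[R]_m)
    (P2 : 'rV[R]_s) x y u w : Prop :=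
  [/\ ((f (row_mx x y))%:E - value x + r1%:E <= 0)%E,
      OmegaCS (g (row_mx x y) - r2) (- u + r3),
      H1 (triple x y u) + P1 = 0
    & C (H2 (quad x y u w) + P2)].

Definition perturbation_norm (r1 : R) (r2 r3 : 'rV[R]_p) (P1 : 'rV[R]_m)
    (P2 : 'rV[R]_s) : R :=
  enorm (row_mx (row_mx (row_mx (row_mx (r1%:M : 'rV_1) r2) r3) P1) P2).

Definition clarke_calm x0 y0 u0 w0 : Prop :=
  exists eps mu : R, [/\ 0 < eps, 0 <= mu
    & forall r1 r2 r3 P1 P2, perturbation_norm r1 r2 r3 P1 P2 < eps ->
      forall x y u w, enorm (quad x y u w - quad x0 y0 u0 w0) < eps ->
        perturbed_feasible r1 r2 r3 P1 P2 x y u w ->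
        0 <= F (row_mx x y) - F (row_mx x0 y0) +
             mu * perturbation_norm r1 r2 r3 P1 P2].

Definition Ig x y u : pred 'I_p :=
  [pred j | (g (row_mx x y) 0 j == 0) && (0 < u 0 j)].

Definition Iu x y u : pred 'I_p :=
  [pred j | (g (row_mx x y) 0 j < 0) && (u 0 j == 0)].

Definition I0 x y u : pred 'I_p :=
  [pred j | (g (row_mx x y) 0 j == 0) && (u 0 j == 0)].

Definition J0 x y : pred 'I_p := [pred j | g (row_mx x y) 0 j == 0].

(* The set mu (grad f - clarke_grad V x {0}), read as {0} when mu = 0, even if
   V is not Lipschitz near x. *)
Definition value_term (mu : R) x y : set 'rV[R]_(n + m) :=
  [set t | (mu = 0 /\ t = 0) \/
           (mu <> 0 /\ exists2 xi, clarke_grad value x xi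
              & t = mu *: (grad f (row_mx x y) - row_mx xi 0))].

Definition stationary_with (I0_condition : R -> R -> Prop) x y u w : Prop :=
  feasible_GCP x y u w /\
  exists (mu : R) (lg lu : 'rV[R]_p) (l1 : 'rV[R]_m) (l2 : 'rV[R]_s),
  [/\ 0 <= mu,
      (exists2 t, value_term mu x y t &
        0 = row_mx (row_mx (grad F (row_mx x y) + t + lg *m Dmx g (row_mx x y))
                           0) 0
            - row_mx (row_mx 0 lu) 0
            + row_mx (l1 *m Dmx H1 (triple x y u)) 0
            + l2 *m Dmx H2 (quad x y u w)),
      [/\ forall j, Iu x y u j -> lg 0 j = 0,
          forall j, Ig x y u j -> lu 0 j = 0
        & normal_cone C (H2 (quad x y u w)) l2]
    & forall j, I0 x y u j -> I0_condition (lg 0 j) (lu 0 j)].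

Definition M_stationary :=
  stationary_with (fun a b => (0 < a /\ 0 < b) \/ a * b = 0).

Definition S_stationary := stationary_with (fun a b => 0 <= a /\ 0 <= b).

(* The multipliers lg and lu only matter on J0 and on Iu, I0 respectively;
   their other entries are unused. *)
Definition MPEC_LICQ x y u w : Prop :=
  forall (lg lu : 'rV[R]_p) (l1 : 'rV[R]_m) (l2 : 'rV[R]_s),
    0 = \sum_(j | J0 x y j)
          lg 0 j *: row_mx (row_mx (grad (fun z => g z 0 j) (row_mx x y)) 0) 0
        - row_mx (row_mx 0 (\sum_(j | Iu x y u j || I0 x y u j)
                              lu 0 j *: delta_mx 0 j)) 0
        + row_mx (l1 *m Dmx H1 (triple x y u)) 0
        + l2 *m Dmx H2 (quad x y u w) ->
    affine_hull (normal_cone C (H2 (quad x y u w))) l2 ->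
    [/\ forall j, J0 x y j -> lg 0 j = 0,
        forall j, Iu x y u j || I0 x y u j -> lu 0 j = 0,
        l1 = 0 & l2 = 0].

End gcp.

(* Main.v *)
Require Import Defs.
From HB Require Import structures.
From mathcomp Require Import all_boot all_order all_algebra.
From mathcomp Require Import all_classical all_reals all_analysis.
From mathcomp Require Import ring lra.

(* Both parts rest on one Fritz John theorem, proved by quadratic penalization.
   Write the constraints as h0 <= 0 and h \in K, with h0 = f - V in part (a),
   and let (z_i, k_i) minimize
     phi z + (i+1) (max(h0 z, 0)^2 + |h z - k|^2) + |z - zb|^2 + |k - h zb|^2
   over k \in K near the solution zb.  Then z_i tends to zb, optimality in k says
   that h z_i - k_i is almost a proximal normal to K at k_i, and optimality in z
   is a stationarity condition in which V enters only through an upper bound of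
   its strict difference quotients.  Normalizing the residuals and passing to
   the limit along an ultrafilter yields multipliers; the one on K is a limiting
   normal, and limiting normals of the complementarity set have the signs of
   M-stationarity.  C need not be closed, so it is first replaced by polytopes
   spanned by finitely many of its points.

   (a) Calmness is an exact penalty and bounds the residuals, so the multiplier
   of F does not vanish.  The limit condition reads eta v <= lf a whenever a
   bounds the difference quotients of V in the direction v near xb, that is,
   eta / lf is a Clarke subgradient of V.

   (b) Applied to the two branches of the complementarity set on which all of I0
   is assigned to g = 0, respectively to u = 0, the theorem yields multipliers
   that MPEC LICQ forces to be normal and to coincide; each branch gives one of
   the two signs. *)

Import Order.TTheory GRing.Theory Num.Theory.
Import numFieldNormedType.Exports.
Local Open Scope classical_set_scope.
Local Open Scope ring_scope.

(** Since [V] is only Lipschitz and enters [f - V] with a minus sign, no chain rule applies to it.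
    Two facts make one-sided information enough. The square of the positive part of [h0] has the
    nonnegative derivative [2 * max(h0, 0)], so an upper bound on the increments of [h0] is all that
    the optimality condition needs. And an increment of [- V] along [d] is an increment of [V] along
    [- d] from the shifted base point; strict quotients tolerate the shift, so upper bounds for [V]
    suffice, and Clarke's directional derivative is the infimum of such bounds. The two proximity
    terms make the minimizers converge to [zb], which need not be a strict minimizer; their
    gradients vanish in the limit. The separate variable [k] avoids differentiating a distance to
    the nonconvex [K]. Minimizers come from compactness, hence the need for closed constraint sets.
    Ultrafilters serve both limits: the finite subsets of [C] are directed by inclusion but in
    general have no cofinal sequence. *)

Section dot_product.
Context {R : realType}.

(** * Algebra and norm estimates for the dot product *)

Section fixed_dimension.
Context {n : nat}.
Implicit Types a b c : 'rV[R]_n.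

Lemma dotpC a b : dotp a b = dotp b a.
Proof. by apply: eq_bigr => i _; rewrite mulrC. Qed.

Lemma dotpDl a b c : dotp (a + b) c = dotp a c + dotp b c.
Proof. by rewrite -big_split; apply: eq_bigr => i _; rewrite mxE mulrDl. Qed.

Lemma dotpDr a b c : dotp a (b + c) = dotp a b + dotp a c.
Proof. by rewrite dotpC dotpDl !(dotpC a). Qed.

Lemma dotpZl k a b : dotp (k *: a) b = k * dotp a b.
Proof. by rewrite mulr_sumr; apply: eq_bigr => i _; rewrite mxE mulrA. Qed.

Lemma dotpZr k a b : dotp a (k *: b) = k * dotp a b.
Proof. by rewrite dotpC dotpZl dotpC. Qed.

Lemma dotpNl a b : dotp (- a) b = - dotp a b.
Proof. by rewrite -scaleN1r dotpZl mulN1r. Qed.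

Lemma dotpNr a b : dotp a (- b) = - dotp a b.
Proof. by rewrite dotpC dotpNl dotpC. Qed.

Lemma dotpBl a b c : dotp (a - b) c = dotp a c - dotp b c.
Proof. by rewrite dotpDl dotpNl. Qed.

Lemma dotp0l a : dotp 0 a = 0.
Proof. by rewrite -(scale0r a) dotpZl mul0r. Qed.

Lemma dotp0r a : dotp a 0 = 0.
Proof. by rewrite dotpC dotp0l. Qed.

Lemma dotp_delta a i : dotp a (delta_mx 0 i) = a 0 i.
Proof.
rewrite /dotp (bigD1 i)//= big1 ?addr0 ?mxE ?eqxx ?mulr1// => j ji.
by rewrite mxE (negbTE ji) mulr0.
Qed.

Lemma dotp_lin2 (x y : R) a b c (d : 'rV[R]_n) :
  dotp (x *: a + y *: b + c) d = x * dotp a d + y * dotp b d + dotp c d.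
Proof. by rewrite !dotpDl !dotpZl. Qed.

Lemma dotp_suml k (v : 'I_k -> 'rV[R]_n) b :
  dotp (\sum_i v i) b = \sum_i dotp (v i) b.
Proof.
rewrite /dotp exchange_big; apply: eq_bigr => j _.
by rewrite summxE mulr_suml.
Qed.

Lemma dotp_ge0 a : 0 <= dotp a a.
Proof. by apply: sumr_ge0 => i _; rewrite -expr2 sqr_ge0. Qed.

Lemma sqr_coord_le_dotp a i : a 0 i ^+ 2 <= dotp a a.
Proof.
rewrite /dotp (bigD1 i)//= -expr2 lerDl.
by apply: sumr_ge0 => j _; rewrite -expr2 sqr_ge0.
Qed.

Lemma dotp_eq0 a : dotp a a <= 0 -> a = 0.
Proof.
move=> a0; apply/rowP => i; rewrite mxE; apply/eqP.
rewrite -[_ == 0](@expf_eq0 R (a 0 i) 2) eq_le sqr_ge0 andbT.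
exact: le_trans (sqr_coord_le_dotp a i) a0.
Qed.

Lemma dotp_inj a b : (forall d, dotp a d = dotp b d) -> a = b.
Proof. by move=> ab; apply/rowP => i; rewrite -!dotp_delta ab. Qed.

Lemma dotp_ge0_eq0 a : (forall d, 0 <= dotp a d) -> a = 0.
Proof.
by move=> a0; apply: dotp_eq0; rewrite -oppr_ge0 -dotpNr.
Qed.

Lemma normr_coord_le a i : `|a 0 i| <= `|a|.
Proof.
rewrite [leRHS]/Num.Def.normr/= mx_normrE.
exact: (le_bigmax _ (fun ij : 'I_1 * 'I_n => `|a ij.1 ij.2|) (0, i)).
Qed.

Lemma rV_norm_le a (e : R) : 0 <= e -> (forall i, `|a 0 i| <= e) -> `|a| <= e.
Proof.
move=> e0 ae; rewrite [leLHS]/Num.Def.normr/= mx_normrE.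
by apply: bigmax_le => // -[i j] _ /=; rewrite ord1.
Qed.

Lemma sqr_norm_le_dotp a : `|a| ^+ 2 <= dotp a a.
Proof.
rewrite -[leRHS]sqr_sqrtr ?dotp_ge0// lerXn2r ?nnegrE ?sqrtr_ge0//.
apply: rV_norm_le; rewrite ?sqrtr_ge0// => i.
by rewrite -sqrtr_sqr ler_wsqrtr// sqr_coord_le_dotp.
Qed.

Lemma dotp_le_norm a b : `|dotp a b| <= n%:R * (`|a| * `|b|).
Proof.
apply: le_trans (ler_norm_sum _ _ _) _.
apply: le_trans (_ : \sum_(i < n) `|a| * `|b| <= _).
  by apply: ler_sum => i _; rewrite normrM ler_pM// normr_coord_le.
by rewrite sumr_const card_ord mulr_natl.
Qed.

(** A crude constant, chosen positive even for [n = 0] so that radii can be divided by it. *)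
Lemma enorm_le_norm a : enorm a <= n.+1%:R * `|a|.
Proof.
rewrite -[leRHS]ger0_norm ?mulr_ge0// -sqrtr_sqr ler_wsqrtr//.
apply: le_trans (ler_norm _) _; apply: le_trans (dotp_le_norm _ _) _.
rewrite -expr2 exprMn ler_wpM2r ?sqr_ge0// -natrX ler_nat.
by rewrite (leq_trans (leqnSn n))// -{1}[n.+1]expn1 leq_pexp2l.
Qed.

End fixed_dimension.

Lemma dotp_row_mx {n1 n2} (a1 b1 : 'rV[R]_n1) (a2 b2 : 'rV[R]_n2) :
  dotp (row_mx a1 a2) (row_mx b1 b2) = dotp a1 b1 + dotp a2 b2.
Proof.
by rewrite /dotp big_split_ord/=; congr (_ + _); apply: eq_bigr => i _;
  rewrite ?row_mxEl ?row_mxEr.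
Qed.

Lemma norm_row_mx_le {n1 n2} (a1 : 'rV[R]_n1) (a2 : 'rV[R]_n2) (e : R) :
  (`|row_mx a1 a2| <= e) = (`|a1| <= e) && (`|a2| <= e).
Proof.
apply/idP/andP => [ae|[a1e a2e]].
  have e0 : 0 <= e by apply: le_trans ae.
  split; apply: rV_norm_le => // i; apply: le_trans ae.
    by rewrite -(row_mxEl a1 a2) normr_coord_le.
  by rewrite -(row_mxEr a1 a2) normr_coord_le.
have e0 : 0 <= e by apply: le_trans a1e.
apply: rV_norm_le => // i; rewrite -[i]splitK; case: (fintype.split i) => j /=.
  by rewrite row_mxEl (le_trans (normr_coord_le _ _)).
by rewrite row_mxEr (le_trans (normr_coord_le _ _)).
Qed.

Lemma norm_lsubmx_le {n1 n2} (a : 'rV[R]_(n1 + n2)) : `|lsubmx a| <= `|a|.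
Proof.
by have := lexx `|a|; rewrite -{1}[a]hsubmxK norm_row_mx_le => /andP[].
Qed.

Lemma norm_rsubmx_le {n1 n2} (a : 'rV[R]_(n1 + n2)) : `|rsubmx a| <= `|a|.
Proof.
by have := lexx `|a|; rewrite -{1}[a]hsubmxK norm_row_mx_le => /andP[].
Qed.

(** * Coordinatewise limits *)

Section limits.
Context {T : Type} {F : set_system T} {FF : Filter F} {n : nat}.

Lemma cvg_coord (f : T -> 'rV[R]_n) (a : 'rV[R]_n) i :
  f @ F --> a -> (fun x => f x 0 i) @ F --> a 0 i.
Proof.
move=> fa; apply: (cvg_comp f (fun v : 'rV[R]_n => v 0 i) fa).
exact: coord_continuous.
Qed.

Lemma cvg_rV (f : T -> 'rV[R]_n) (a : 'rV[R]_n) :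
  (forall i, (fun x => f x 0 i) @ F --> a 0 i) -> f @ F --> a.
Proof.
move=> fa; apply/cvgrPdist_le => e e0; near=> x.
apply: rV_norm_le; first exact: ltW.
move=> i; rewrite !mxE; move: i; near: x; apply: filter_forall => i.
exact: ((cvgrPdist_le _ _).1 (fa i)).
Unshelve. all: by end_near. Qed.

Lemma cvg_dotp (f g : T -> 'rV[R]_n) (a b : 'rV[R]_n) :
  f @ F --> a -> g @ F --> b -> (fun x => dotp (f x) (g x)) @ F --> dotp a b.
Proof.
move=> fa gb; apply: cvg_big => [|i _]; first exact: add_continuous.
by apply: cvgM; exact: cvg_coord.
Qed.

Lemma cvg_sqr_dist (f : T -> 'rV[R]_n) (a c : 'rV[R]_n) : f @ F --> a ->
  (fun x => dotp (f x - c) (f x - c)) @ F --> dotp (a - c) (a - c).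
Proof.
move=> fa; have fc : (fun x => f x - c) @ F --> a - c.
  by apply: cvgB => //; exact: cvg_cst.
exact: cvg_dotp.
Qed.

End limits.

End dot_product.

Lemma continuous_pair_cst {T U : topologicalType} (k : T) :
  continuous (fun v : U => (k, v)).
Proof. by move=> v; apply: cvg_pair; [exact: cvg_cst|exact: cvg_id]. Qed.

Lemma nbhs_dist_lt {R : realType} {V : normedModType R} (c : V) (e : R) :
  0 < e -> \forall x \near c, `|x - c| < e.
Proof. by move=> e0; apply: (cvgr_distC_lt id c) => //; exact: cvg_id. Qed.

Lemma cvg_right_id {R : realType} (a : R) : (fun t : R => t) @ a^'+ --> a.
Proof. exact: (@cvg_within _ (nbhs a)). Qed.

(** * Limits along ultrafilters *)

Section ultrafilters.

Lemma fmap_ultra {I T : Type} (f : I -> T) (U : set_system I) :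
  UltraFilter U -> UltraFilter (f @ U).
Proof.
move=> UU; split; first exact: fmap_proper_filter.
move=> G GG UG; apply/seteqP; split => // A GA.
have [//|UnA] := in_ultra_setVsetC (f @^-1` A) UU.
have : G (~` A) by exact: UG.
by move=> /(filterI GA); rewrite setICr => /filter_not_empty.
Qed.

Lemma ultra_compact_cvg {I : Type} {T : topologicalType} (f : I -> T)
    (U : set_system I) (A : set T) :
  UltraFilter U -> compact A -> (\forall i \near U, A (f i)) ->
  exists2 a, A a & f @ U --> a.
Proof.
move=> UU; rewrite compact_ultra => cA UA.
by have [a [Aa fa]] := cA _ (fmap_ultra f _ UU) UA; exists a.
Qed.

End ultrafilters.

Lemma compact_norm_ball {R : realType} {n} (c : 'rV[R]_n) (r : R) :
  compact [set z | `|z - c| <= r].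
Proof.
apply: bounded_closed_compact.
  exists (r + `|c|); split; first exact: num_real.
  move=> M rM z /= zr; apply: le_trans (ltW rM).
  by rewrite -[z](subrK c) (le_trans (ler_normD _ _))// lerD2r.
have cc : continuous (fun z : 'rV[R]_n => `|z - c|).
  move=> z; apply: (@cvg_norm _ _ _ (nbhs z) _).
  by apply: cvgB; [exact: cvg_id|exact: cvg_cst].
rewrite -[mkset _]/((fun z : 'rV[R]_n => `|z - c|) @^-1` [set x | x <= r]).
by apply: preimage_closed; [move=> z _; exact: cc|exact: closed_le].
Qed.

(** * Proximal and limiting normals *)

Section proximal_normals.
Context {R : realType} {n : nat}.

Definition prox_normal (K : set 'rV[R]_n) (k v : 'rV[R]_n) : Prop :=
  exists s, \forall k' \near k, K k' ->
    dotp v (k' - k) <= s * dotp (k' - k) (k' - k).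

(** The limiting (Mordukhovich) normal cone, encoded through the closed graph so that base point and
    normal may pass to the limit together. *)
Definition limiting_normal (K : set 'rV[R]_n) (k : 'rV[R]_n) : set 'rV[R]_n :=
  [set v | closure [set q | K q.1 /\ prox_normal K q.1 q.2] (k, v)].

Lemma closed_limiting_normal (K : set 'rV[R]_n) k :
  closed (limiting_normal K k).
Proof.
apply: (@preimage_closed _ _ (fun v : 'rV[R]_n => (k, v))).
  by move=> v _; exact: continuous_pair_cst.
exact: closed_closure.
Qed.

Lemma limiting_normalP (K : set 'rV[R]_n) k v (e : R) :
  limiting_normal K k v -> 0 < e ->
  exists k' v', [/\ `|k' - k| < e, `|v' - v| < e, K k' & prox_normal K k' v'].
Proof.
move=> kv e0.
have : nbhs (k, v) ([set k' | `|k' - k| < e] `*` [set v' | `|v' - v| < e]).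
  exists ([set k' | `|k' - k| < e], [set v' | `|v' - v| < e]) => //=.
  by split; [exact: (nbhs_dist_lt k _ e0)|exact: (nbhs_dist_lt v _ e0)].
by move=> /kv[[k' v'] /= [[Kk' kv'] [? ?]]]; exists k', v'.
Qed.

(** The quadratic error of the proximal inequality is of order [t ^+ 2] along the segment and
    disappears after division by [t]. *)
Lemma prox_normal_dir (K : set 'rV[R]_n) k v d :
  prox_normal K k v -> (\forall t \near 0^'+, K (k + t *: d)) ->
  dotp v d <= 0.
Proof.
move=> [s kv] Kd.
have kd : (fun t : R => k + t *: d) @ 0^'+ --> k.
  rewrite -[X in _ --> X]addr0 -(scale0r d).
  apply: cvgD; first exact: cvg_cst.
  by apply: cvgZ; [exact: cvg_right_id|exact: cvg_cst].
have sd : (fun t : R => t * (s * dotp d d)) @ 0^'+ --> 0.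
  rewrite -[X in _ --> X](mul0r (s * dotp d d)).
  by apply: cvgM; [exact: cvg_right_id|exact: cvg_cst].
have {}kv := kd _ kv.
apply: (cvgr_to_ge sd); near=> t.
have t0 : 0 < t by near: t; exact: nbhs_right_gt.
have : K (k + t *: d) by near: t.
have : K (k + t *: d) -> dotp v (k + t *: d - k) <=
     s * dotp (k + t *: d - k) (k + t *: d - k) by near: t; exact: kv.
move=> /[apply]; rewrite addrAC subrr add0r !dotpZl !dotpZr => H.
by rewrite -(ler_pM2l t0); apply: (le_trans H); rewrite le_eqVlt;
  apply/orP; left; apply/eqP; ring.
Unshelve. all: by end_near. Qed.

End proximal_normals.

(** * Strict directional derivatives *)

Section strict_derivatives.
Context {R : realType} {n : nat}.
Implicit Types (phi psi : 'rV[R]_n -> R) (z d : 'rV[R]_n).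

(* The filter of the strict difference quotients: the base point tends to z
   while the step tends to 0 from above. *)
Definition steps z : set_system ('rV[R]_n * R) :=
  filter_prod (nbhs z) (0 : R)^'+.

Definition quotient phi d (q : 'rV[R]_n * R) : R :=
  (phi (q.1 + q.2 *: d) - phi q.1) / q.2.

(** The strict directional derivative. A derivative with fixed base point [zb] would say nothing at
    the minimizers of the penalty, which only tend to [zb]. *)
Definition sderiv phi z d (a : R) : Prop := quotient phi d @ steps z --> a.

#[global] Instance steps_proper z : ProperFilter (steps z).
Proof. exact: filter_prod_proper. Qed.

Lemma steps_gt0 z : \forall q \near steps z, 0 < q.2.
Proof.
exists (setT, [set t | 0 < t]) => [|q []//].
by split; [exact: filterT|exact: nbhs_right_gt].
Qed.

Lemma steps_all z (P : set ('rV[R]_n * R)) :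
  (forall q, P q) -> \forall q \near steps z, P q.
Proof. exact: filterE. Qed.

Lemma steps_fst z : (fun q : 'rV[R]_n * R => q.1) @ steps z --> z.
Proof. exact: cvg_fst. Qed.

Lemma steps_snd z : (fun q : 'rV[R]_n * R => q.2) @ steps z --> (0 : R).
Proof. exact: (cvg_trans (@cvg_snd _ _ (nbhs z) _ _) (cvg_right_id 0)). Qed.

Lemma steps_shift z d :
  (fun q : 'rV[R]_n * R => q.1 + q.2 *: d) @ steps z --> z.
Proof.
rewrite -[X in _ --> X]addr0 -(scale0r d).
apply: cvgD; first exact: steps_fst.
by apply: cvgZ; [exact: steps_snd|exact: cvg_cst].
Qed.

Lemma steps_near z (P : 'rV[R]_n -> R -> Prop) :
  (\forall q \near steps z, P q.1 q.2) ->
  \forall z' \near z, \forall t \near (0 : R)^'+, P z' t.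
Proof.
move=> [[A B] /= [zA B0] AB]; apply: filterS zA => z' Az'.
by apply: filterS B0 => t Bt; exact: (AB (z', t)).
Qed.

Lemma sderivD phi psi z d a b : sderiv phi z d a -> sderiv psi z d b ->
  sderiv (fun x => phi x + psi x) z d (a + b).
Proof.
move=> pa pb; rewrite /sderiv (_ : quotient _ _ = quotient phi d \+ quotient psi d).
  exact: cvgD.
by apply/funext => q; rewrite /quotient /= -mulrDl opprD addrACA.
Qed.

Lemma sderivZ k phi z d a : sderiv phi z d a ->
  sderiv (fun x => k * phi x) z d (k * a).
Proof.
move=> pa; rewrite /sderiv (_ : quotient _ _ = (fun q => k * quotient phi d q)).
  by apply: cvgM; [exact: cvg_cst|exact: pa].
by apply/funext => q; rewrite /quotient /= mulrA mulrBr.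
Qed.

Lemma sderiv_sum m (phi : 'I_m -> 'rV[R]_n -> R) z d (a : 'I_m -> R) :
  (forall i, sderiv (phi i) z d (a i)) ->
  sderiv (fun x => \sum_i phi i x) z d (\sum_i a i).
Proof.
move=> pa.
rewrite /sderiv (_ : quotient _ _ = (fun q => \sum_i quotient (phi i) d q)).
  by apply: cvg_big => [|i _]; [exact: add_continuous|exact: pa].
by apply/funext => q; rewrite /quotient /= -mulr_suml sumrB.
Qed.

Lemma sderivM phi psi z d a b :
  {for z, continuous phi} -> {for z, continuous psi} ->
  sderiv phi z d a -> sderiv psi z d b ->
  sderiv (fun x => phi x * psi x) z d (phi z * b + psi z * a).
Proof.
move=> cphi cpsi pa pb.
have cp : (fun q : 'rV[R]_n * R => phi (q.1 + q.2 *: d)) @ steps z --> phi z.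
  by apply: (cvg_comp _ _ (steps_shift z d)).
have cq : (fun q : 'rV[R]_n * R => psi q.1) @ steps z --> psi z.
  by apply: (cvg_comp _ _ (steps_fst z)).
rewrite /sderiv (_ : quotient _ _ = (fun q => phi (q.1 + q.2 *: d) *
  quotient psi d q + psi q.1 * quotient phi d q)).
  exact: cvgD (cvgM cp pb) (cvgM cq pa).
by apply/funext => q; rewrite /quotient /= !mulrA -mulrDl; congr (_ / _); ring.
Qed.

Lemma sderiv_id i z d : sderiv (fun x => x 0 i) z d (d 0 i).
Proof.
apply: cvg_near_cst; near=> q.
have q0 : 0 < q.2 by near: q; exact: steps_gt0.
by rewrite /quotient !mxE addrAC subrr add0r mulrAC divff ?mul1r ?gt_eqF.
Unshelve. all: by end_near. Qed.

Lemma sderiv_le_near phi z d a e : sderiv phi z d a -> 0 < e ->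
  \forall q \near steps z, `|phi (q.1 + q.2 *: d) - phi q.1 - q.2 * a| <= q.2 * e.
Proof.
move=> /cvgrPdist_le pa e0; near=> q.
have q0 : 0 < q.2 by near: q; exact: steps_gt0.
have : `|a - quotient phi d q| <= e by near: q; exact: pa.
rewrite -(ler_pM2l q0) -[X in X * _ <= _]gtr0_norm// -normrM distrC => H.
apply: le_trans H; rewrite /quotient mulrBr mulrCA divff ?gt_eqF// mulr1.
by rewrite distrC.
Unshelve. all: by end_near. Qed.

End strict_derivatives.

Lemma sderiv_comp_linear {R : realType} {n m : nat}
    (L : {linear 'rV[R]_n -> 'rV[R]_m}) (phi : 'rV[R]_m -> R) z d a :
  {for z, continuous L} ->
  sderiv phi (L z) (L d) a -> sderiv (phi \o L) z d a.
Proof.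
move=> cL pa.
have cLs : (fun q : 'rV[R]_n * R => (L q.1, q.2)) @ steps z --> steps (L z).
  have c1 : (fun q : 'rV[R]_n * R => L q.1) @ steps z --> L z.
    exact: (cvg_comp _ _ (steps_fst z)).
  have c2 : (fun q : 'rV[R]_n * R => q.2) @ steps z --> (0 : R)^'+.
    exact: (@cvg_snd _ _ (nbhs z)).
  exact: (cvg_pair c1 c2).
rewrite /sderiv (_ : quotient _ _ =
  (fun q => quotient phi (L d) (L q.1, q.2))).
  exact: (cvg_comp _ _ cLs pa).
by apply/funext => q; rewrite /quotient /= linearD linearZ.
Qed.

(** * Optimality conditions for the quadratic penalty *)

Section quadratic_penalty.
Context {R : realType} {N M : nat}.
Variables (phi h0 : 'rV[R]_N -> R) (h : 'rV[R]_N -> 'rV[R]_M).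
Variable (zb : 'rV[R]_N).
Implicit Types (z d : 'rV[R]_N) (k : 'rV[R]_M) (rho : R).

Definition penalty rho z k : R :=
  phi z + rho * (Num.max (h0 z) 0 ^+ 2 + dotp (h z - k) (h z - k)) +
  dotp (z - zb) (z - zb) + dotp (k - h zb) (k - h zb).

(** The squared positive part is differentiable with the 2-Lipschitz derivative [2 * max(a, 0)],
    which gives a second-order upper bound with coefficient 1. *)
Lemma sqr_max0_le (a b : R) :
  Num.max b 0 ^+ 2 <= Num.max a 0 ^+ 2 + Num.max a 0 * (b - a) *+ 2 + (b - a) ^+ 2.
Proof.
case: (lerP a 0) => a0; case: (lerP b 0) => b0.
- by rewrite !expr0n mul0r mul0rn !add0r sqr_ge0.
- by rewrite !expr0n mul0r mul0rn !add0r lerXn2r ?nnegrE; lra.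
- have -> : a ^+ 2 + a * (b - a) *+ 2 + (b - a) ^+ 2 = b ^+ 2 by ring.
  by rewrite expr0n sqr_ge0.
- by rewrite le_eqVlt; apply/orP; left; apply/eqP; ring.
Qed.

Lemma dotp_sqrD {n} (a b : 'rV[R]_n) :
  dotp (a + b) (a + b) = dotp a a + dotp a b *+ 2 + dotp b b.
Proof. by rewrite dotpDl !dotpDr (dotpC b a); ring. Qed.

(** Besides first-order conditions, this serves to discard an arbitrarily small error: the error
    size itself is taken as [t]. *)
Lemma ge0_of_near0 (X Y : R) :
  (\forall t \near 0^'+, 0 <= t * X + t ^+ 2 * Y) -> 0 <= X.
Proof.
move=> XY; have sd : (fun t : R => X + t * Y) @ 0^'+ --> X + 0 * Y.
  apply: cvgD; first exact: cvg_cst.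
  by apply: cvgM; [exact: cvg_right_id|exact: cvg_cst].
rewrite mul0r addr0 in sd.
apply: (cvgr_to_ge sd); near=> t.
have t0 : 0 < t by near: t; exact: nbhs_right_gt.
by rewrite -(pmulr_rge0 _ t0) mulrDr mulrA -expr2; near: t.
Unshelve. all: by end_near. Qed.

(** The increment of [h0] is multiplied by [max(h0 z, 0)], so the one-sided bound [a] is enough; the
    two-sided bound [L] enters only at order [t ^+ 2]. The error [e] in linearizing [h] comes
    multiplied by the residual, hence stays bounded when the residuals are normalized. *)
Lemma penalty_stationary rho z k d (a0 a e L : R) (b : 'rV[R]_M) :
  0 <= rho -> 0 <= e ->
  (\forall t \near 0^'+,
    [/\ phi (z + t *: d) - phi z <= t * a0,
        h0 (z + t *: d) - h0 z <= t * a,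
        `|h0 (z + t *: d) - h0 z| <= L * t,
        forall j, `|h (z + t *: d) 0 j - h z 0 j - t * b 0 j| <= t * e
      & penalty rho z k <= penalty rho (z + t *: d) k]) ->
  0 <= a0 + 2 * rho * (Num.max (h0 z) 0 * a + dotp (h z - k) b
                       + e * (M%:R * `|h z - k|)) + 2 * dotp (z - zb) d.
Proof.
move=> rho0 e0 H.
(* Coefficient of [t ^+ 2], collecting the squared increments of [h0], of [h] and of the proximity
   term. *)
pose Y := rho * (L ^+ 2 + M%:R * (`|b| + e) ^+ 2) + dotp d d.
apply: (@ge0_of_near0 _ Y); near=> t.
have t0 : 0 < t by near: t; exact: nbhs_right_gt.
have [ph ha hL hb pen] : [/\ phi (z + t *: d) - phi z <= t * a0,
        h0 (z + t *: d) - h0 z <= t * a,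
        `|h0 (z + t *: d) - h0 z| <= L * t,
        forall j, `|h (z + t *: d) 0 j - h z 0 j - t * b 0 j| <= t * e
      & penalty rho z k <= penalty rho (z + t *: d) k] by near: t.
pose v := h (z + t *: d) - h z - t *: b.
have ve : `|v| <= t * e.
  by apply: rV_norm_le => [|j]; [rewrite mulr_ge0// ltW|rewrite !mxE].
have hE : h (z + t *: d) - k = (h z - k) + (t *: b + v).
  by apply/rowP => j; rewrite !mxE; ring.
have zE : z + t *: d - zb = (z - zb) + t *: d by rewrite addrAC.
move: pen; clearbody v.
rewrite /penalty hE zE (dotp_sqrD (h z - k)) (dotp_sqrD (z - zb)).
rewrite (dotpDr (h z - k) (t *: b)) (dotpZr t (h z - k)) (dotpZr t (z - zb)).
rewrite (dotpZl t d) (dotpZr t d).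
set D := dotp (h z - k) (h z - k); set Db := dotp (h z - k) b.
set m := Num.max (h0 z) 0.
have pm := sqr_max0_le (h0 z) (h0 (z + t *: d)).
rewrite -/m in pm.
have m0 : 0 <= m by rewrite le_max lexx orbT.
have sq1 : (h0 (z + t *: d) - h0 z) ^+ 2 <= t ^+ 2 * L ^+ 2.
  by rewrite -exprMn mulrC -real_normK ?num_real// lerXn2r ?nnegrE//; exact: le_trans hL.
have dv : dotp (h z - k) v <= t * (e * (M%:R * `|h z - k|)).
  apply: le_trans (ler_norm _) _; apply: le_trans (dotp_le_norm _ _) _.
  have : `|h z - k| * `|v| <= `|h z - k| * (t * e) by rewrite ler_wpM2l.
  move=> /(ler_wpM2l (ler0n R M)) /le_trans; apply.
  by rewrite le_eqVlt; apply/orP; left; apply/eqP; ring.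
have sq2 : dotp (t *: b + v) (t *: b + v) <= t ^+ 2 * (M%:R * (`|b| + e) ^+ 2).
  have nb : `|t *: b + v| <= t * (`|b| + e).
    by rewrite mulrDr (le_trans (ler_normD _ _))// lerD// normrZ gtr0_norm.
  apply: le_trans (ler_norm _) _; apply: le_trans (dotp_le_norm _ _) _.
  rewrite [leRHS]mulrCA ler_wpM2l// -exprMn -expr2 lerXn2r ?nnegrE//.
  by rewrite (le_trans _ nb).
have ma : m * (h0 (z + t *: d) - h0 z) <= m * (t * a) by rewrite ler_wpM2l.
set P := Num.max (h0 (z + t *: d)) 0 in pm *.
set S := dotp (t *: b + v) (t *: b + v) in sq2 *.
set V := dotp (h z - k) v in dv *.
have : rho * (P ^+ 2 - m ^+ 2 + (t * Db + V) *+ 2 + S) <=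
  rho * (2 * (m * (t * a)) + t ^+ 2 * L ^+ 2 +
     (t * Db + t * (e * (M%:R * `|h z - k|))) *+ 2 +
     t ^+ 2 * (M%:R * (`|b| + e) ^+ 2)).
  rewrite ler_wpM2l//; lra.
rewrite /Y; set A := `|h z - k|; set B := (`|b| + e); move=> K1 K2.
clear -K1 K2 ph; lra.
Unshelve. all: by end_near. Qed.

(** As a function of [k] the penalty is exactly quadratic: minus its gradient is the normal, and its
    second-order coefficient [rho + 1] is the proximal constant. The factor [c] is the later
    normalization. *)
Lemma penalty_prox rho (K : set 'rV[R]_M) z k (c : R) : 0 <= c ->
  (\forall k' \near k, K k' -> penalty rho z k <= penalty rho z k') ->
  prox_normal K k (c *: ((2 * rho) *: (h z - k) - 2 *: (k - h zb))).
Proof.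
move=> c0 H; exists (c * (rho + 1)); apply: filterS H => k' /[apply].
rewrite /penalty dotpZl -mulrA.
have -> : h z - k' = (h z - k) + (k - k') by apply/rowP => j; rewrite !mxE; ring.
have -> : k' - h zb = (k - h zb) + (k' - k).
  by apply/rowP => j; rewrite !mxE; ring.
rewrite -(opprB k' k) (dotp_sqrD (h z - k)) (dotp_sqrD (k - h zb)).
rewrite !(dotpNr (h z - k)) dotpNl dotpNr opprK.
rewrite (dotpBl ((2 * rho) *: (h z - k))) (dotpZl (2 * rho)) (dotpZl 2) => H.
rewrite ler_wpM2l//.
move: H; set X := dotp (h z - k) (k' - k); set Y := dotp (k - h zb) (k' - k).
by lra.
Qed.

End quadratic_penalty.

(** * Convergence of the penalty minimizers *)

Section penalty_limits.
Context {R : realType} {N M : nat}.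
Variables (phi h0 : 'rV[R]_N -> R) (h : 'rV[R]_N -> 'rV[R]_M).
Variable (zb : 'rV[R]_N).

Definition infeasibility z k : R :=
  Num.max (h0 z) 0 ^+ 2 + dotp (h z - k) (h z - k).

Lemma cvg_max0 {T : Type} {F : set_system T} {FF : Filter F} (f : T -> R) (a : R) :
  f @ F --> a -> (fun t => Num.max (f t) 0) @ F --> Num.max a 0.
Proof.
move=> fa; apply: (@continuous_cvg _ _ _ F _ f (fun x : R => Num.max x 0)) => //.
by apply: (@continuous_max _ _ id (cst 0)); [exact: cvg_id|exact: cvg_cst].
Qed.

Lemma cvg_infeasibility {T : Type} {F : set_system T} {FF : Filter F}
    (z : T -> 'rV[R]_N) (k : T -> 'rV[R]_M) z' k' :
  h0 \o z @ F --> h0 z' -> h \o z @ F --> h z' -> k @ F --> k' ->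
  (fun t => infeasibility (z t) (k t)) @ F --> infeasibility z' k'.
Proof.
move=> ch0 ch ck; apply: cvgD.
  by apply: cvgM; exact: cvg_max0.
by apply: cvg_dotp; apply: cvgB.
Qed.

Lemma cvg_penalty {T : Type} {F : set_system T} {FF : Filter F}
    (z : T -> 'rV[R]_N) (k : T -> 'rV[R]_M) z' k' rho :
  z @ F --> z' -> phi \o z @ F --> phi z' ->
  h0 \o z @ F --> h0 z' -> h \o z @ F --> h z' -> k @ F --> k' ->
  (fun t => penalty phi h0 h zb rho (z t) (k t)) @ F -->
    penalty phi h0 h zb rho z' k'.
Proof.
move=> cz cphi ch0 ch ck; apply: cvgD; first apply: cvgD; first apply: cvgD.
- exact: cphi.
- by apply: cvgM; [exact: cvg_cst|exact: cvg_infeasibility].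
- exact: cvg_sqr_dist.
- exact: cvg_sqr_dist.
Qed.

Lemma infeasibility_ge0 z k : 0 <= infeasibility z k.
Proof. by rewrite addr_ge0 ?sqr_ge0 ?dotp_ge0. Qed.

Lemma infeasibility_eq0 z k :
  infeasibility z k <= 0 -> h0 z <= 0 /\ h z = k.
Proof.
move=> Q0; have Q1 := sqr_ge0 (Num.max (h0 z) 0).
have Q2 := dotp_ge0 (h z - k); rewrite /infeasibility in Q0.
split; last by apply/eqP; rewrite -subr_eq0; apply/eqP/dotp_eq0; lra.
suff /eqP : Num.max (h0 z) 0 ^+ 2 == 0.
  by move/eqP; rewrite sqrf_eq0 => /eqP <-; rewrite le_max lexx.
by rewrite eq_le Q1 andbT; lra.
Qed.

Lemma sqr_le_infeasibility z k :
  (Num.max (h0 z) 0 + `|h z - k|) ^+ 2 <= 2 * infeasibility z k.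
Proof.
have := sqr_norm_le_dotp (h z - k); rewrite /infeasibility.
set a := Num.max _ _; set b := `|_|; have := sqr_ge0 (a - b); nra.
Qed.

(** Comparison with [(zb, h zb)], where the penalty equals [phi zb], makes every limit point
    feasible. Local minimality then leaves no room for the proximity terms, so the limit is
    [(zb, h zb)]. *)
Lemma penalty_minimizers (K : set 'rV[R]_M) (r : R) :
  0 < r -> closed K -> K (h zb) -> h0 zb <= 0 ->
  (forall z, `|z - zb| <= r ->
    [/\ {for z, continuous phi}, {for z, continuous h0}
      & {for z, continuous h}]) ->
  (forall z, `|z - zb| <= r -> h0 z <= 0 -> K (h z) -> phi zb <= phi z) ->
  exists (U : set_system nat) (z : nat -> 'rV[R]_N) (k : nat -> 'rV[R]_M),
  [/\ UltraFilter U, z @ U --> zb, k @ U --> h zb,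
      forall i, [/\ `|z i - zb| <= r, `|k i - h zb| <= r & K (k i)]
    & forall i z' k', `|z' - zb| <= r -> `|k' - h zb| <= r -> K k' ->
        penalty phi h0 h zb i.+1%:R (z i) (k i) <=
        penalty phi h0 h zb i.+1%:R z' k'].
Proof.
move=> r0 clK Kb h0b cont locmin.
pose X : set ('rV[R]_N * 'rV[R]_M) :=
  [set z | `|z - zb| <= r] `*` (K `&` [set k | `|k - h zb| <= r]).
have cKr : compact (K `&` [set k | `|k - h zb| <= r]).
  by rewrite setIC; apply: compact_closedI => //; exact: compact_norm_ball.
have cX : compact X.
  apply: compact_setX; first exact: compact_norm_ball.
  exact: cKr.
have Xb : X (zb, h zb) by rewrite /X /= !subrr !normr0 ltW.
pose P i (q : 'rV[R]_N * 'rV[R]_M) := penalty phi h0 h zb i.+1%:R q.1 q.2.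
have /choice[q qP] : forall i, exists q, X q /\ forall q', X q' -> P i q <= P i q'.
  move=> i; have [||q /set_mem Xq qmin] := @compact_EVT_min _ _ (P i) X _ cX.
  - by exists (zb, h zb).
  - apply: continuous_in_subspaceT => q /set_mem [/= /cont[c1 c2 c3] _].
    have f1 : (fun q : 'rV[R]_N * 'rV[R]_M => q.1) @ nbhs q --> q.1 by exact: cvg_fst.
    have f2 : (fun q : 'rV[R]_N * 'rV[R]_M => q.2) @ nbhs q --> q.2 by exact: cvg_snd.
    apply: (@cvg_penalty _ (nbhs q) _ (fun q => q.1) (fun q => q.2)) => //.
    + exact: (cvg_comp _ _ f1 c1).
    + exact: (cvg_comp _ _ f1 c2).
    + exact: (cvg_comp _ _ f1 c3).
  by exists q; split => // q' Xq'; apply: qmin; exact: mem_set.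
have [U [UU sU]] := ultraFilterLemma (F := \oo : set_system nat) _.
exists U, (fun i => (q i).1), (fun i => (q i).2).
have Xq i : X (q i) by have [] := qP i.
have [z' /= z'r cz] := @ultra_compact_cvg _ _ (fun i => (q i).1) U _ UU
  (@compact_norm_ball _ _ zb r) (filterE _ (fun i => (Xq i).1)).
have [k' [Kk' k'r] ck] := @ultra_compact_cvg _ _ (fun i => (q i).2) U
  (K `&` [set k | `|k - h zb| <= r]) UU
  cKr (filterE _ (fun i => (Xq i).2)).
have [c1 c2 c3] := cont _ z'r.
have cphi := cvg_comp _ _ cz c1.
have ch0 := cvg_comp _ _ cz c2.
have ch := cvg_comp _ _ cz c3.
have Pb i : P i (q i) <= phi zb.
  have [_ /(_ _ Xb)] := qP i; rewrite {2}/P /penalty /= !subrr !dotp0l.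
  by rewrite (max_idPr h0b) expr0n/= !addr0 mulr0 addr0.
have Pge i : phi (q i).1 + dotp ((q i).1 - zb) ((q i).1 - zb) +
    dotp ((q i).2 - h zb) ((q i).2 - h zb) <= phi zb.
  apply: le_trans (Pb i); rewrite /P /penalty -/(infeasibility _ _).
  by have := mulr_ge0 (ler0n R i.+1) (infeasibility_ge0 (q i).1 (q i).2); lra.
(* [Pb] bounds the infeasibility by [phi zb - phi z_i] divided by [i.+1]; the numerator converges,
   so the bound tends to 0. *)
have /infeasibility_eq0[h0z' hz'] : infeasibility z' k' <= 0.
  rewrite -(mulr0 (phi zb - phi z')).
  have cQ : (fun i => infeasibility (q i).1 (q i).2) @ U -->
      infeasibility z' k' by exact: cvg_infeasibility.
  have cR : (fun i => (phi zb - phi (q i).1) * harmonic i) @ U -->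
      (phi zb - phi z') * 0.
    apply: cvgM; first by apply: cvgB; [exact: cvg_cst|exact: cphi].
    by move=> A /cvg_harmonic /sU.
  apply: (ler_cvg_to cQ cR).
  apply: nearW => i; rewrite /harmonic/= ler_pdivlMr// mulrC.
  have := Pb i; rewrite /P /penalty -/(infeasibility _ _).
  have := dotp_ge0 ((q i).1 - zb); have := dotp_ge0 ((q i).2 - h zb).
  by rewrite /=; lra.
have : phi z' + dotp (z' - zb) (z' - zb) + dotp (k' - h zb) (k' - h zb) <= phi zb.
  have cPh : (fun i => phi (q i).1 + dotp ((q i).1 - zb) ((q i).1 - zb) +
      dotp ((q i).2 - h zb) ((q i).2 - h zb)) @ U -->
      phi z' + dotp (z' - zb) (z' - zb) + dotp (k' - h zb) (k' - h zb).
    apply: cvgD; first apply: cvgD => //.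
      exact: cvg_sqr_dist.
    exact: cvg_sqr_dist.
  by apply: (cvgr_to_le cPh); exact: nearW.
have := locmin z' z'r h0z'; rewrite hz' => /(_ Kk') phib pz.
have sz := dotp_ge0 (z' - zb); have sk := dotp_ge0 (k' - h zb).
have z'E : z' = zb by apply/eqP; rewrite -subr_eq0; apply/eqP/dotp_eq0; lra.
have k'E : k' = h zb by rewrite -hz' z'E.
split => //.
- by rewrite -z'E.
- by rewrite -k'E.
- by move=> i; have [? []] := Xq i.
- by move=> i z'' k'' ? ? ?; have [_ /(_ (z'', k''))] := qP i; apply; split.
Qed.

End penalty_limits.

(** Transfers a strict estimate at [zb] to ordinary one-sided estimates at the moving points
    [z i]. *)
Lemma filter_steps_at {R : realType} {n : nat} {I : Type} {F : set_system I}
    {FF : Filter F} (z : I -> 'rV[R]_n) zb (P : 'rV[R]_n -> R -> Prop) :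
  z @ F --> zb -> (\forall q \near steps zb, P q.1 q.2) ->
  \forall i \near F, \forall t \near (0 : R)^'+, P (z i) t.
Proof. by move=> zF /steps_near /zF. Qed.

(* The multipliers are limits of the normalized residuals of the quadratic
   penalty.  An exact penalty with constant mu bounds these residuals before
   normalization, hence keeps l0 away from 0. *)
Lemma fritz_john_closed {R : realType} {N M : nat}
    (phi h0 : 'rV[R]_N -> R) (h : 'rV[R]_N -> 'rV[R]_M) (K : set 'rV[R]_M)
    (zb : 'rV[R]_N) (Dphi : 'rV[R]_N -> R) (Dh : 'rV[R]_N -> 'rV[R]_M) (r : R) :
  0 < r -> closed K -> K (h zb) -> h0 zb <= 0 ->
  (forall z, `|z - zb| <= r ->
    [/\ {for z, continuous phi}, {for z, continuous h0}
      & {for z, continuous h}]) ->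
  (forall z, `|z - zb| <= r -> h0 z <= 0 -> K (h z) -> phi zb <= phi z) ->
  (forall d, sderiv phi zb d (Dphi d)) ->
  (forall d j, sderiv (fun z => h z 0 j) zb d (Dh d 0 j)) ->
  (forall d, exists L, \forall q \near steps zb,
     `|h0 (q.1 + q.2 *: d) - h0 q.1| <= L * q.2) ->
  exists (l0 lf : R) (l : 'rV[R]_M),
  [/\ [/\ 0 <= l0, 0 <= lf, l0 + lf + `|l| = 1 & 0 <= lf * h0 zb],
      limiting_normal K (h zb) l,
      forall d a, (\forall q \near steps zb,
         h0 (q.1 + q.2 *: d) - h0 q.1 <= q.2 * a) ->
         0 <= l0 * Dphi d + lf * a + dotp l (Dh d)
    & forall mu, 0 <= mu ->
        (forall z k, `|z - zb| <= r -> `|k - h zb| <= r -> K k ->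
           phi zb <= phi z + mu * (Num.max (h0 z) 0 + `|h z - k|)) ->
        1 <= l0 * (1 + 4 * mu)].
Proof.
move=> r0 clK Kb h0b cont locmin Sphi Sh Lh0.
have [U [z [k [UU cz ck zkr pmin]]]] :=
  penalty_minimizers phi h0 h zb K r r0 clK Kb h0b cont locmin.
have UF : Filter U by typeclasses eauto.
have cont0 : [/\ {for zb, continuous phi}, {for zb, continuous h0}
      & {for zb, continuous h}] by apply: cont; rewrite subrr normr0 ltW.
have [c1 c2 c3] := cont0.
have ch0 := cvg_comp _ _ cz c2.
pose rho i : R := i.+1%:R.
pose m i := Num.max (h0 (z i)) 0.
have m0 i : 0 <= m i by rewrite le_max lexx orbT.
have rho0 i : 0 < rho i by rewrite ltr0n.
(* The weight 1 of the objective plus the sizes of the raw multipliers [2 * rho * m] and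
   [2 * rho * (h z - k)]; dividing by it puts all multipliers in a compact set. *)
pose S i := 1 + 2 * rho i * (m i + `|h (z i) - k i|).
have S1 i : 1 <= S i.
  by rewrite lerDl mulr_ge0// ?mulr_ge0// ?addr_ge0// ltW.
have S0 i : 0 < S i by apply: lt_le_trans (S1 i).
pose c i := (S i)^-1.
have c0 i : 0 < c i by rewrite invr_gt0.
pose lf_ i := c i * (2 * rho i * m i).
pose l_ i : 'rV[R]_M := (c i * (2 * rho i)) *: (h (z i) - k i).
have lfge0 i : 0 <= lf_ i.
  by rewrite mulr_ge0// ?mulr_ge0// ltW.
have nl i : `|l_ i| = c i * (2 * rho i) * `|h (z i) - k i|.
  by rewrite normrZ gtr0_norm// mulr_gt0// mulr_gt0.
have sum1 i : c i + lf_ i + `|l_ i| = 1.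
  rewrite nl /lf_ -[X in _ = X](mulVf (lt0r_neq0 (S0 i))) -/(c i) /S; ring.
have [l0 _ cl0] := @ultra_compact_cvg _ _ c U _ UU (@segment_compact R 0 1)
  ltac:(by apply: nearW => i /=; rewrite in_itv/= ltW//=;
    have := sum1 i; have := lfge0 i; have := normr_ge0 (l_ i); lra).
have [lf _ clf] := @ultra_compact_cvg _ _ lf_ U _ UU (@segment_compact R 0 1)
  ltac:(by apply: nearW => i /=; rewrite in_itv/= lfge0/=;
    have := sum1 i; have := c0 i; have := normr_ge0 (l_ i); lra).
have [l _ cl] := @ultra_compact_cvg _ _ l_ U _ UU (@compact_norm_ball _ _ (0 : 'rV[R]_M) 1)
  ltac:(by apply: nearW => i /=; rewrite subr0;
    have := sum1 i; have := c0 i; have := lfge0 i; lra).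
have l0ge : 0 <= l0 by apply: (cvgr_to_ge cl0); apply: nearW => i; exact: ltW.
have lfge : 0 <= lf by apply: (cvgr_to_ge clf); apply: nearW.
exists l0, lf, l; split.
- split; [exact: l0ge|exact: lfge| |].
    have cs : (fun i => c i + lf_ i + `|l_ i|) @ U --> l0 + lf + `|l|.
      by apply: cvgD; [exact: cvgD|exact: cvg_norm].
    have c1' : (fun i => c i + lf_ i + `|l_ i|) @ U --> (1 : R).
      by under eq_fun do rewrite sum1; exact: cvg_cst.
    exact: (cvg_unique _ cs c1').
  have cs : (fun i => lf_ i * h0 (z i)) @ U --> lf * h0 zb by apply: cvgM.
  apply: (cvgr_to_ge cs); apply: nearW => i.
  have -> : lf_ i * h0 (z i) = c i * (2 * rho i) * (m i * h0 (z i)).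
    by rewrite /lf_; ring.
  apply: mulr_ge0; first by rewrite ltW// mulr_gt0// mulr_gt0.
  by rewrite /m; case: (lerP (h0 (z i)) 0) => hi; rewrite ?mul0r// mulr_ge0// ltW.
(* The genuine proximal normals; they differ from [l_] by the proximity term, which tends to 0
   because [k i] tends to [h zb]. *)
- pose v i : 'rV[R]_M := c i *: ((2 * rho i) *: (h (z i) - k i) - 2 *: (k i - h zb)).
  have cv : v @ U --> l.
    have vE : v = fun i => l_ i - (c i * 2) *: (k i - h zb).
      by apply/funext => i; rewrite /v /l_ scalerBr !scalerA.
    rewrite vE -[X in _ --> X]subr0 -(scaler0 _ (l0 * 2)) -(subrr (h zb)).
    apply: cvgB => //; apply: cvgZ; first by apply: cvgM => //; exact: cvg_cst.
    by apply: cvgB => //; exact: cvg_cst.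
  have ckv : (fun i => (k i, v i)) @ U --> (h zb, l).
    exact: (cvg_pair ck cv).
  pose A : set ('rV[R]_M * 'rV[R]_M) := [set q | K q.1 /\ prox_normal K q.1 q.2].
  apply: (@closed_cvg _ _ U _ (fun i => (k i, v i)) (closure A) _ _ _ ckv).
    exact: closed_closure.
  (* Minimality is known only in the closed ball, so [k i] must lie in its interior for all nearby
     [k'] to be competitors. *)
  have kr : \forall i \near U, `|k i - h zb| < r.
    exact: (cvgr_distC_lt _ _ ck r r0).
  apply: filterS kr => i kir; apply: subset_closure => /=.
  have [zir _ Kki] := zkr i; split => //.
  apply: penalty_prox; first exact: ltW.
  have : \forall k' \near k i, `|k' - h zb| < r.
    have : \forall k' \near k i, `|k' - k i| < r - `|k i - h zb|.
      by apply: nbhs_dist_lt; rewrite subr_gt0.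
    apply: filterS => k' kk'; rewrite -(subrK (k i) k') -addrA.
    by rewrite (le_lt_trans (ler_normD _ _))// -ltrBrDr.
  by apply: filterS => k' /ltW kk' Kk'; exact: pmin.
- move=> d a up; have [L {}Lh0] := Lh0 d.
  pose W := M%:R * `|l|.
  (* The slack [e] turns strict derivatives into inequalities valid at the [z i]; it is removed only
     after the limit in [i]. *)
  suff main e : 0 < e -> 0 <= l0 * (Dphi d + e) + lf * a + (dotp l (Dh d) + e * W).
    apply: (@ge0_of_near0 _ _ (l0 + W)); near=> t.
    have t0 : 0 < t by near: t; exact: nbhs_right_gt.
    by have := main t t0; move=> /(mulr_ge0 (ltW t0)); congr (0 <= _); ring.
  move=> e0.
  have near1 : \forall q \near steps zb,
    [/\ phi (q.1 + q.2 *: d) - phi q.1 <= q.2 * (Dphi d + e),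
        h0 (q.1 + q.2 *: d) - h0 q.1 <= q.2 * a,
        `|h0 (q.1 + q.2 *: d) - h0 q.1| <= L * q.2,
        forall j, `|h (q.1 + q.2 *: d) 0 j - h q.1 0 j - q.2 * Dh d 0 j| <= q.2 * e
      & `|q.1 + q.2 *: d - zb| <= r].
    near=> q; split.
    + have : `|phi (q.1 + q.2 *: d) - phi q.1 - q.2 * Dphi d| <= q.2 * e.
        by near: q; exact: sderiv_le_near.
      by move=> /(le_trans (ler_norm _)); lra.
    + by near: q.
    + by near: q.
    + near: q; apply: filter_forall => j.
      exact: (sderiv_le_near _ _ _ _ _ (Sh d j) e0).
    + by apply: ltW; near: q; exact: (cvgr_distC_lt _ _ (steps_shift zb d) r r0).
  have {}near1 := @filter_steps_at _ _ _ U UF z zb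
    (fun x t => [/\ phi (x + t *: d) - phi x <= t * (Dphi d + e),
        h0 (x + t *: d) - h0 x <= t * a,
        `|h0 (x + t *: d) - h0 x| <= L * t,
        forall j, `|h (x + t *: d) 0 j - h x 0 j - t * Dh d 0 j| <= t * e
      & `|x + t *: d - zb| <= r]) cz near1.
  have cs : (fun i => c i * (Dphi d + e) + lf_ i * a +
      (dotp (l_ i) (Dh d) + e * (M%:R * `|l_ i|)) +
      c i * (2 * dotp (z i - zb) d)) @ U -->
    l0 * (Dphi d + e) + lf * a + (dotp l (Dh d) + e * W) + l0 * (2 * dotp (zb - zb) d).
    apply: cvgD; first apply: cvgD; first apply: cvgD.
    + by apply: cvgM => //; exact: cvg_cst.
    + by apply: cvgM => //; exact: cvg_cst.
    + apply: cvgD; first by apply: cvg_dotp => //; exact: cvg_cst.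
      apply: cvgM; first exact: cvg_cst.
      by apply: cvgM; [exact: cvg_cst|exact: cvg_norm].
    + apply: cvgM => //; apply: cvgM; first exact: cvg_cst.
      by apply: cvg_dotp; [apply: cvgB => //; exact: cvg_cst|exact: cvg_cst].
  rewrite subrr dotp0l !mulr0 addr0 in cs.
  apply: (cvgr_to_ge cs); apply: filterS near1 => i Hi.
  have [_ kir Kki] := zkr i.
  have : 0 <= (Dphi d + e) + 2 * rho i * (Num.max (h0 (z i)) 0 * a +
      dotp (h (z i) - k i) (Dh d) + e * (M%:R * `|h (z i) - k i|)) +
      2 * dotp (z i - zb) d.
    apply: (@penalty_stationary _ _ _ phi h0 h zb (rho i) (z i) (k i) d
              (Dphi d + e) a e L (Dh d)); rewrite ?ltW//.
    by apply: filterS Hi => t [? ? ? ? ?]; split => //; exact: pmin.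
  move=> /(mulr_ge0 (ltW (c0 i))); congr (0 <= _).
  by rewrite nl /l_ /lf_ /m dotpZl; ring.
- move=> mu mu0 calm.
  have cs : (fun i => c i * (1 + 4 * mu)) @ U --> l0 * (1 + 4 * mu).
    by apply: cvgM => //; exact: cvg_cst.
  apply: (cvgr_to_ge cs); apply: nearW => i.
  rewrite mulrC ler_pdivlMr// mul1r.
  have [zir kir Kki] := zkr i.
  have calmi := calm _ _ zir kir Kki.
  have := pmin i zb (h zb); rewrite !subrr !normr0 => /(_ (ltW r0) (ltW r0) Kb).
  rewrite /penalty !subrr !dotp0l (max_idPr h0b) expr0n/= !addr0 mulr0 addr0.
  rewrite -/(infeasibility _ _ _ _) -/(rho i) => pb.
  have := dotp_ge0 (z i - zb); have := dotp_ge0 (k i - h zb).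
  have := sqr_le_infeasibility h0 h (z i) (k i).
  rewrite -/(m i) in calmi *; rewrite /S.
  set s := m i + `|_| in calmi *; set Q := infeasibility _ _ _ _ in pb * => sQ kk zz.
  have s0 : 0 <= s by rewrite addr_ge0.
  (* Minimality against [zb] meets the exact penalty bound. With [s ^+ 2 <= 2 * Q] this gives
     [rho * s <= 2 * mu], hence [S <= 1 + 4 * mu]. *)
  have Qs : rho i * Q <= mu * s by lra.
  rewrite lerD2l; suff : rho i * s <= 2 * mu by lra.
  have : rho i * s ^+ 2 <= 2 * mu * s.
    by have := ler_wpM2l (ltW (rho0 i)) sQ; lra.
  have [s00|sn0] := eqVneq s 0; first by rewrite s00 mulr0; lra.
  have sp : 0 < s by rewrite lt_def sn0.
  by rewrite expr2 mulrA ler_pM2r.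
Unshelve. all: by end_near. Qed.

(** * Convex hulls of finitely many points *)

Section polytopes.
Context {R : realType} {n : nat}.
Implicit Types (c x : 'rV[R]_n) (S : seq 'rV[R]_n) (C : set 'rV[R]_n).

(** The convex hull of [c] and the points of [S], built as iterated joins, which gives compactness
    by induction without barycentric coordinates. *)
Fixpoint polytope c S : set 'rV[R]_n :=
  if S is a :: S' then
    [set v | exists x t, [/\ polytope c S' x, 0 <= t <= 1 & v = x + t *: (a - x)]]
  else [set c].

Lemma convex_set_segment C x y (t : R) : convex_set C -> C x -> C y ->
  0 <= t <= 1 -> C (x + t *: (y - x)).
Proof.
move=> cvxC Cx Cy /andP[t0 t1].
have := cvxC y x (Itv01 t0 t1) (mem_set Cy) (mem_set Cx).
move=> /set_mem; congr C; apply/rowP => i.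
by rewrite !mxE /= /unstable.onem; ring.
Qed.

Lemma polytope_base c S : polytope c S c.
Proof.
elim: S => [//|a S IH] /=; exists c, 0; split => //.
  by rewrite lexx ler01.
by rewrite scale0r addr0.
Qed.

Lemma polytope_sub C c S : convex_set C -> C c ->
  (forall a, a \in S -> C a) -> polytope c S `<=` C.
Proof.
move=> cvxC Cc; elim: S => [|a S IH] SC /= x; first by move=> ->.
move=> [y [t [yS t01 ->]]]; apply: convex_set_segment => //.
  by apply: IH yS => b bS; apply: SC; rewrite inE bS orbT.
by apply: SC; rewrite mem_head.
Qed.

Lemma polytope_star c S x a (t : R) : polytope c S x -> a \in S ->
  0 < t <= 1 -> polytope c S (x + t *: (a - x)).
Proof.
elim: S x t => [//|b S IH] x t /= [y [u [yS /andP[u0 u1] ->]]].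
rewrite inE => /orP[/eqP ->|aS] /andP[t0 t1].
  exists y, (1 - (1 - t) * (1 - u)); split => //.
    have : 0 <= (1 - t) * (1 - u) by rewrite mulr_ge0 ?subr_ge0.
    have : (1 - t) * (1 - u) <= 1 by rewrite mulr_ile1 ?subr_ge0//; lra.
    by move=> ? ?; apply/andP; split; lra.
  by apply/rowP => i; rewrite !mxE; ring.
(* The new point has weights [(1 - t) * (1 - u)] on [y], [(1 - t) * u] on [b] and [t] on [a]. The
   mass off [b] is positive as [t > 0]; dividing by it yields a point of the smaller polytope by
   induction. *)
have tu : (1 - t) * u <= 1 - t by rewrite ler_piMr// subr_ge0.
have tu0 : 0 <= (1 - t) * u by rewrite mulr_ge0// subr_ge0.
have D0 : 0 < 1 - (1 - t) * u by lra.
exists (y + (t / (1 - (1 - t) * u)) *: (a - y)), ((1 - t) * u); split => //.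
- by apply: IH => //; rewrite divr_gt0//= ler_pdivrMr// mul1r; lra.
- by rewrite tu0; lra.
- by apply/rowP => i; rewrite !mxE; field; rewrite gt_eqF.
Qed.

Lemma compact_polytope c S : compact (polytope c S).
Proof.
elim: S => [|a S IH] /=; first exact: compact_set1.
pose f (q : 'rV[R]_n * R) := q.1 + q.2 *: (a - q.1).
have -> : [set v | exists x t, [/\ polytope c S x, 0 <= t <= 1 &
    v = x + t *: (a - x)]] = f @` (polytope c S `*` `[0, 1]).
  apply/seteqP; split => v /=.
    by move=> [x [t [Sx t01 ->]]]; exists (x, t) => //; split => //=; rewrite in_itv.
  by move=> [[x t] /= [Sx]]; rewrite in_itv/= => t01 <-; exists x, t.
apply: continuous_compact; last first.
  by apply: compact_setX => //; exact: segment_compact.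
apply: continuous_subspaceT => q.
have f1 : (fun q : 'rV[R]_n * R => q.1) @ nbhs q --> q.1 by exact: cvg_fst.
have f2 : (fun q : 'rV[R]_n * R => q.2) @ nbhs q --> q.2 by exact: cvg_snd.
apply: (@cvgD _ _ _ (nbhs q) _) => //.
apply: (@cvgZ _ _ _ (nbhs q) _) => //.
apply: (@cvgB _ _ _ (nbhs q) _) => //; exact: (@cvg_cst _ _ _ (nbhs q) _).
Qed.

End polytopes.

(** * Normals to a product set *)

Section product_normals.
Context {R : realType} {n1 n2 : nat}.
Implicit Types (K : set 'rV[R]_n1) (D : set 'rV[R]_n2).

Definition row_setX K D : set 'rV[R]_(n1 + n2) :=
  [set k | K (lsubmx k) /\ D (rsubmx k)].

Lemma closed_row_setX K D : closed K -> closed D -> closed (row_setX K D).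
Proof.
move=> cK cD.
apply: (@closedI _ (lsubmx @^-1` K) (rsubmx @^-1` D)).
  apply: preimage_closed => // k _; exact: continuous_lsubmx.
apply: preimage_closed => // k _; exact: continuous_rsubmx.
Qed.

Lemma limiting_normalI {n} (K : set 'rV[R]_n) k v :
  (forall e, 0 < e ->
    exists k' v', [/\ `|k' - k| < e, `|v' - v| < e, K k' & prox_normal K k' v']) ->
  limiting_normal K k v.
Proof.
move=> H B [[B1 B2] /= [/nbhs_normP[e1 e10 eB1] /nbhs_normP[e2 e20 eB2] BB]].
have [k' [v' [kk vv Kk' pn]]] := H (Num.min e1 e2) ltac:(by rewrite lt_min e10).
exists (k', v'); split => //; apply: BB; split => /=.
  by apply: eB1; rewrite /= distrC (lt_le_trans kk)// ge_min lexx.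
by apply: eB2; rewrite /= distrC (lt_le_trans vv)// ge_min lexx orbT.
Qed.

(** Freezing the second component at that of the nearby base point restricts the proximal inequality
    to [K]. *)
Lemma limiting_normal_row_setX_l K D k v :
  limiting_normal (row_setX K D) k v ->
  limiting_normal K (lsubmx k) (lsubmx v).
Proof.
move=> kv; apply: limiting_normalI => e e0.
have [k' [v' [kk vv [Kk' Dk'] [s pn]]]] := limiting_normalP _ _ _ _ kv e0.
exists (lsubmx k'), (lsubmx v'); split => //.
- by rewrite -linearB (le_lt_trans (norm_lsubmx_le _)).
- by rewrite -linearB (le_lt_trans (norm_lsubmx_le _)).
exists s; have /nbhs_normP[r r0 rpn] := pn.
apply/nbhs_normP; exists r => // a /= ka Ka.
have := rpn (row_mx a (rsubmx k')); rewrite /row_setX /= row_mxKl row_mxKr.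
have -> : k' - row_mx a (rsubmx k') = row_mx (lsubmx k' - a) 0.
  by rewrite -{1}[k']hsubmxK opp_row_mx add_row_mx subrr.
have -> : row_mx a (rsubmx k') - k' = row_mx (a - lsubmx k') 0.
  by rewrite -{2}[k']hsubmxK opp_row_mx add_row_mx subrr.
have nr : `|row_mx (lsubmx k' - a) (0 : 'rV[R]_n2)| < r.
  apply: le_lt_trans ka; rewrite norm_row_mx_le lexx normr0/=; exact: normr_ge0.
move=> /(_ nr (conj Ka Dk')).
by rewrite -{1}[v']hsubmxK !dotp_row_mx !dotp0r !addr0.
Qed.

(** Moving towards a generator [a] stays in the polytope from every base point, so the inequality
    holds for all nearby proximal normals; being a closed condition, it survives the limit. *)
Lemma limiting_normal_row_setX_r K c S k v a :
  rsubmx k = c -> a \in S ->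
  limiting_normal (row_setX K (polytope c S)) k v ->
  dotp (rsubmx v) (a - c) <= 0.
Proof.
move=> kc aS kv.
pose B : set ('rV[R]_(n1 + n2) * 'rV[R]_(n1 + n2)) :=
  [set q | dotp (rsubmx q.2) (a - rsubmx q.1) <= 0].
have clB : closed B.
  apply: (@preimage_closed _ _ (fun q : 'rV[R]_(n1 + n2) * 'rV[R]_(n1 + n2) =>
     dotp (rsubmx q.2) (a - rsubmx q.1)) [set x | x <= 0]); last exact: closed_le.
  move=> q _.
  have g1 : (fun q : 'rV[R]_(n1 + n2) * 'rV[R]_(n1 + n2) => q.1) @ nbhs q --> q.1.
    exact: cvg_fst.
  have g2 : (fun q : 'rV[R]_(n1 + n2) * 'rV[R]_(n1 + n2) => q.2) @ nbhs q --> q.2.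
    exact: cvg_snd.
  have f1 : (fun q : 'rV[R]_(n1 + n2) * 'rV[R]_(n1 + n2) => rsubmx q.1) @ nbhs q
      --> rsubmx q.1 by exact: (cvg_comp _ _ g1 (@continuous_rsubmx R 1 n1 n2 q.1)).
  have f2 : (fun q : 'rV[R]_(n1 + n2) * 'rV[R]_(n1 + n2) => rsubmx q.2) @ nbhs q
      --> rsubmx q.2 by exact: (cvg_comp _ _ g2 (@continuous_rsubmx R 1 n1 n2 q.2)).
  apply: (@cvg_dotp _ _ (nbhs q) _) => //.
  by apply: (@cvgB _ _ _ (nbhs q) _) => //; exact: (@cvg_cst _ _ _ (nbhs q) _).
have : B (k, v); last by rewrite /B /= kc.
apply: clB; move: kv; apply: closureS => -[k' v'] /= [[Kk' Sk'] pn].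
rewrite /B /=.
have -> : dotp (rsubmx v') (a - rsubmx k') =
    dotp v' (row_mx 0 (a - rsubmx k')).
  by rewrite -{2}[v']hsubmxK dotp_row_mx dotp0r add0r.
apply: (prox_normal_dir _ _ _ _ pn); near=> t.
have -> : k' + t *: row_mx 0 (a - rsubmx k') =
    row_mx (lsubmx k') (rsubmx k' + t *: (a - rsubmx k')).
  by rewrite -{1}[k']hsubmxK scale_row_mx scaler0 add_row_mx addr0.
rewrite /row_setX /= row_mxKl row_mxKr; split => //.
apply: polytope_star => //; apply/andP; split.
  by near: t; exact: nbhs_right_gt.
by near: t; exact: nbhs_right_le.
Unshelve. all: by end_near. Qed.

End product_normals.

(** * The filter of finite subsets *)

Section finite_subsets.
Context {T : eqType} (C : set T).

(* Sequences stand for finite subsets of C, directed by inclusion. *)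
Definition finite_subsets : set_system (seq T) :=
  [set A : set (seq T) | exists2 S0 : seq T, (forall c, c \in S0 -> C c) &
     forall S : seq T, {subset S0 <= S} -> (forall c, c \in S -> C c) -> A S].

#[global] Instance finite_subsets_proper : ProperFilter finite_subsets.
Proof.
split; first by move=> [S0 SC] /(_ S0 (fun _ => id) SC).
split.
- by exists [::].
- move=> A B [SA SAC HA] [SB SBC HB]; exists (SA ++ SB).
    by move=> c; rewrite mem_cat => /orP[/SAC|/SBC].
  move=> S sS SC; split.
    by apply: HA => // c cS; apply: sS; rewrite mem_cat cS.
  by apply: HB => // c cS; apply: sS; rewrite mem_cat cS orbT.
- by move=> A B AB [S0 SC HA]; exists S0 => // S sS SC'; apply/AB/HA.
Qed.

Lemma finite_subsets_mem c : C c -> \forall S \near finite_subsets, c \in S.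
Proof.
move=> Cc; exists [:: c] => [a|S sS _]; first by rewrite inE => /eqP ->.
by apply: sS; rewrite inE.
Qed.

Lemma finite_subsets_sub : \forall S \near finite_subsets, forall c, c \in S -> C c.
Proof. by exists [::]. Qed.

End finite_subsets.

Lemma continuous_row_mx_comp {R : realType} {n n1 n2 : nat}
    (f1 : 'rV[R]_n -> 'rV[R]_n1) (f2 : 'rV[R]_n -> 'rV[R]_n2) z :
  {for z, continuous f1} -> {for z, continuous f2} ->
  {for z, continuous (fun x => row_mx (f1 x) (f2 x))}.
Proof.
move=> c1 c2; apply: (@cvg_rV _ _ (nbhs z) _ _ (fun x => row_mx (f1 x) (f2 x))) => i.
rewrite -[i]splitK; case: (fintype.split i) => j /=.
  by under eq_fun do rewrite row_mxEl; rewrite row_mxEl; exact: (cvg_coord _ _ j c1).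
by under eq_fun do rewrite row_mxEr; rewrite row_mxEr; exact: (cvg_coord _ _ j c2).
Qed.

(* The convex set C need not be closed: it is exhausted by the polytopes
   spanned by h2 zb and finitely many points of C. *)
Lemma fritz_john {R : realType} {N M s : nat}
    (phi h0 : 'rV[R]_N -> R) (h : 'rV[R]_N -> 'rV[R]_M)
    (h2 : 'rV[R]_N -> 'rV[R]_s) (K : set 'rV[R]_M) (C : set 'rV[R]_s)
    (zb : 'rV[R]_N) (Dphi : 'rV[R]_N -> R) (Dh : 'rV[R]_N -> 'rV[R]_M)
    (Dh2 : 'rV[R]_N -> 'rV[R]_s) (r : R) :
  0 < r -> closed K -> K (h zb) -> convex_set C -> C (h2 zb) -> h0 zb <= 0 ->
  (forall z, `|z - zb| <= r ->
    [/\ {for z, continuous phi}, {for z, continuous h0},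
        {for z, continuous h} & {for z, continuous h2}]) ->
  (forall z, `|z - zb| <= r -> h0 z <= 0 -> K (h z) -> C (h2 z) ->
     phi zb <= phi z) ->
  (forall d, sderiv phi zb d (Dphi d)) ->
  (forall d j, sderiv (fun z => h z 0 j) zb d (Dh d 0 j)) ->
  (forall d j, sderiv (fun z => h2 z 0 j) zb d (Dh2 d 0 j)) ->
  (forall d, exists L, \forall q \near steps zb,
     `|h0 (q.1 + q.2 *: d) - h0 q.1| <= L * q.2) ->
  exists (l0 lf : R) (l : 'rV[R]_M) (l2 : 'rV[R]_s),
  [/\ [/\ 0 <= l0, 0 <= lf, l0 + lf + `|row_mx l l2| = 1 & 0 <= lf * h0 zb],
      limiting_normal K (h zb) l /\ normal_cone C (h2 zb) l2,
      forall d a, (\forall q \near steps zb,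
         h0 (q.1 + q.2 *: d) - h0 q.1 <= q.2 * a) ->
         0 <= l0 * Dphi d + lf * a + (dotp l (Dh d) + dotp l2 (Dh2 d))
    & forall mu, 0 <= mu ->
        (forall z k c, `|z - zb| <= r -> `|k - h zb| <= r ->
           `|c - h2 zb| <= r -> K k -> C c ->
           phi zb <= phi z + mu * (Num.max (h0 z) 0 +
             `|row_mx (h z - k) (h2 z - c)|)) ->
        1 <= l0 * (1 + 4 * mu)].
Proof.
move=> r0 clK Kb cvxC Cb h0b cont locmin Sphi Sh Sh2 Lh0.
pose H z := row_mx (h z) (h2 z).
(* All conclusions are closed conditions on the triple of multipliers, with the normal cone
   inequality tested only on [S]; the limit over [S] restores it on all of [C]. *)
pose cond (S : seq 'rV[R]_s) (q : R * R * 'rV[R]_(M + s)) :=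
  [/\ [/\ 0 <= q.1.1, 0 <= q.1.2, q.1.1 + q.1.2 + `|q.2| = 1 & 0 <= q.1.2 * h0 zb],
      limiting_normal K (h zb) (lsubmx q.2) /\
        (forall c, c \in S -> dotp (rsubmx q.2) (c - h2 zb) <= 0),
      forall d a, (\forall q \near steps zb,
         h0 (q.1 + q.2 *: d) - h0 q.1 <= q.2 * a) ->
         0 <= q.1.1 * Dphi d + q.1.2 * a + dotp q.2 (row_mx (Dh d) (Dh2 d))
    & forall mu, 0 <= mu ->
        (forall z k c, `|z - zb| <= r -> `|k - h zb| <= r ->
           `|c - h2 zb| <= r -> K k -> C c ->
           phi zb <= phi z + mu * (Num.max (h0 z) 0 +
             `|row_mx (h z - k) (h2 z - c)|)) ->
        1 <= q.1.1 * (1 + 4 * mu)].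
have /choice[q qP] : forall S : seq 'rV[R]_s, exists q,
    (forall c, c \in S -> C c) -> cond S q.
  move=> S; have [SC|] := pselect (forall c, c \in S -> C c); last first.
    (* Default value for sequences that leave [C]; the filter ignores them. *)
    by exists (0, 0, 0).
  have PC := polytope_sub _ _ _ cvxC Cb SC.
  have [] := @fritz_john_closed R N (M + s) phi h0 H
    (row_setX K (polytope (h2 zb) S)) zb Dphi
    (fun d => row_mx (Dh d) (Dh2 d)) r r0.
  - apply: closed_row_setX => //; apply: compact_closed; last exact: compact_polytope.
    exact: norm_hausdorff.
  - by rewrite /row_setX /= row_mxKl row_mxKr; split => //; exact: polytope_base.
  - exact: h0b.
  - by move=> z /cont[? ? ? ?]; split => //; exact: continuous_row_mx_comp.
  - move=> z zr hz; rewrite /row_setX /= row_mxKl row_mxKr => -[Kz /PC].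
    exact: locmin.
  - exact: Sphi.
  - move=> d j; rewrite -[j]splitK; case: (fintype.split j) => i /=.
      rewrite row_mxEl (_ : (fun z => _) = (fun z => h z 0 i)) ?Sh//.
      by apply/funext => z; rewrite row_mxEl.
    rewrite row_mxEr (_ : (fun z => _) = (fun z => h2 z 0 i)) ?Sh2//.
    by apply/funext => z; rewrite row_mxEr.
  - exact: Lh0.
  move=> l0 [lf [l [cl nl stat calm]]].
  exists (l0, lf, l) => _; split => //=.
    split.
      have := limiting_normal_row_setX_l _ _ _ _ nl.
      by rewrite /H row_mxKl.
    move=> c cS; apply: (limiting_normal_row_setX_r _ _ _ _ _ _ _ cS nl).
    by rewrite row_mxKr.
  move=> mu mu0 cm; apply: calm => // z k zr kr [Kk Pk].
  have kE z' : H z' - k = row_mx (h z' - lsubmx k) (h2 z' - rsubmx k).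
    by rewrite /H -{1}[k]hsubmxK opp_row_mx add_row_mx.
  move: kr; rewrite distrC !kE norm_row_mx_le distrC (distrC (h2 zb)) => /andP[k1 k2].
  by apply: cm => //; exact: PC.
pose F := finite_subsets C.
have [U [UU FU]] := ultraFilterLemma (finite_subsets_proper C).
have UF : Filter U by typeclasses eauto.
have Uq : \forall S \near U, cond S (q S).
  by apply: FU; apply: filterS (finite_subsets_sub C) => S; exact: qP.
have bnd : \forall S \near U,
    [/\ 0 <= (q S).1.1 <= 1, 0 <= (q S).1.2 <= 1 & `|(q S).2| <= 1].
  apply: filterS Uq => S [[a0 b0 ab _] _ _ _].
  by rewrite a0 b0 /=; have := normr_ge0 (q S).2; split; lra.
have [l0 _ cl0] := @ultra_compact_cvg _ _ (fun S => (q S).1.1) U _ UU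
  (@segment_compact R 0 1)
  ltac:(by apply: filterS bnd => S [? _ _] /=; rewrite in_itv).
have [lf _ clf] := @ultra_compact_cvg _ _ (fun S => (q S).1.2) U _ UU
  (@segment_compact R 0 1)
  ltac:(by apply: filterS bnd => S [_ ? _] /=; rewrite in_itv).
have [l _ cl] := @ultra_compact_cvg _ _ (fun S => (q S).2) U _ UU
  (@compact_norm_ball _ _ (0 : 'rV[R]_(M + s)) 1)
  ltac:(by apply: filterS bnd => S [_ _ ?] /=; rewrite subr0).
have cll : (fun S => lsubmx (q S).2) @ U --> lsubmx l.
  exact: (cvg_comp _ _ cl (@continuous_lsubmx R 1 M s l)).
have clr : (fun S => rsubmx (q S).2) @ U --> rsubmx l.
  exact: (cvg_comp _ _ cl (@continuous_rsubmx R 1 M s l)).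
exists l0, lf, (lsubmx l), (rsubmx l); split.
- split.
  + by apply: (cvgr_to_ge cl0); apply: filterS Uq => S [[]].
  + by apply: (cvgr_to_ge clf); apply: filterS Uq => S [[]].
  + rewrite hsubmxK.
    have cs : (fun S => (q S).1.1 + (q S).1.2 + `|(q S).2|) @ U --> l0 + lf + `|l|.
      by apply: cvgD; [exact: cvgD|exact: cvg_norm].
    have c1' : (fun S => (q S).1.1 + (q S).1.2 + `|(q S).2|) @ U --> (1 : R).
      by apply: cvg_near_cst; apply: filterS Uq => S [[]].
    exact: (cvg_unique _ cs c1').
  + have cs : (fun S => (q S).1.2 * h0 zb) @ U --> lf * h0 zb.
      by apply: cvgM => //; exact: cvg_cst.
    by apply: (cvgr_to_ge cs); apply: filterS Uq => S [[]].
- split.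
    apply: (@closed_cvg _ _ U _ (fun S => lsubmx (q S).2)
      (limiting_normal K (h zb)) _ _ _ cll).
      exact: closed_limiting_normal.
    by apply: filterS Uq => S [_ []].
  split => // c Cc.
  have cs : (fun S => dotp (rsubmx (q S).2) (c - h2 zb)) @ U --> dotp (rsubmx l) (c - h2 zb).
    by apply: cvg_dotp => //; exact: cvg_cst.
  apply: (cvgr_to_le cs).
  have Uc : \forall S \near U, c \in S by apply: FU; exact: finite_subsets_mem.
  by apply: filterS2 Uq Uc => S [_ [_ Sc] _ _]; exact: Sc.
- move=> d a up; rewrite -dotp_row_mx hsubmxK.
  have cs : (fun S => (q S).1.1 * Dphi d + (q S).1.2 * a +
      dotp (q S).2 (row_mx (Dh d) (Dh2 d))) @ U -->
      l0 * Dphi d + lf * a + dotp l (row_mx (Dh d) (Dh2 d)).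
    apply: cvgD; first by apply: cvgD; apply: cvgM => //; exact: cvg_cst.
    by apply: cvg_dotp => //; exact: cvg_cst.
  by apply: (cvgr_to_ge cs); apply: filterS Uq => S [_ _ /(_ d a up)].
- move=> mu mu0 cm.
  have cs : (fun S => (q S).1.1 * (1 + 4 * mu)) @ U --> l0 * (1 + 4 * mu).
    by apply: cvgM => //; exact: cvg_cst.
  by apply: (cvgr_to_ge cs); apply: filterS Uq => S [_ _ _ /(_ mu mu0 cm)].
Qed.

(** * Calculus of continuously differentiable maps *)

Section continuously_differentiable.
Context {R : realType} {n : nat}.
Implicit Types (psi : 'rV[R]_n -> R) (z d : 'rV[R]_n).

Lemma is_derive_line psi z d (t : R) : derivable psi (z + t *: d) d ->
  is_derive t 1 (fun u : R => psi (z + u *: d)) ('D_d psi (z + t *: d)).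
Proof.
have E : (fun h => h^-1 *: (((fun u : R => psi (z + u *: d)) \o shift t) (h *: 1)
      - psi (z + t *: d))) =
   (fun h => h^-1 *: ((psi \o shift (z + t *: d)) (h *: d) - psi (z + t *: d))).
  apply/funext => h /=; congr (_ *: (psi _ - _)).
  by rewrite [h *: 1]mulr1 scalerDl addrCA.
by move=> H; split; rewrite /derivable /derive E.
Qed.

Lemma mvt_line psi z d (t : R) : 0 < t ->
  (forall u, 0 <= u <= t -> differentiable psi (z + u *: d)) ->
  exists2 c, 0 <= c <= t &
    psi (z + t *: d) - psi z = t * 'D_d psi (z + c *: d).
Proof.
move=> t0 dpsi.
have dline (u : R) : 0 <= u <= t ->
    is_derive u 1 (fun u : R => psi (z + u *: d)) ('D_d psi (z + u *: d)).
  by move=> /dpsi ?; apply: is_derive_line; exact: diff_derivable.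
have [||c] := @MVT R (fun u => psi (z + u *: d))
    (fun u => 'D_d psi (z + u *: d)) 0 t t0.
- by move=> u; rewrite in_itv/= => /andP[/ltW u0 /ltW ut]; apply: dline; rewrite u0.
- apply: derivable_within_continuous => u; rewrite in_itv/= => /dline.
  by move=> H; exact: ex_derive.
rewrite in_itv/= => /andP[/ltW c0 /ltW ct].
by rewrite scale0r addr0 subr0 mulrC => E; exists c; rewrite ?c0.
Qed.

(** By the mean value theorem each quotient is the directional derivative at a point of the segment,
    which shrinks to [z]. *)
Lemma sderiv_C1 psi z d : (\forall x \near z, differentiable psi x) ->
  {for z, continuous (fun x => 'D_d psi x)} -> sderiv psi z d ('D_d psi z).
Proof.
move=> dpsi /cvgrPdist_le cD; apply/cvgrPdist_le => e e0.
have /nbhs_normP[r /= r0 rP] : \forall x \near z,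
    differentiable psi x /\ `|'D_d psi z - 'D_d psi x| <= e.
  by apply: filterI => //; exact: cD.
have tr : (fun q : 'rV[R]_n * R => `|q.1 - z| + q.2 * `|d|) @ steps z --> (0 : R).
  have -> : (0 : R) = `|z - z| + 0 * `|d| by rewrite subrr normr0 mul0r addr0.
  apply: cvgD.
    by apply: cvg_norm; apply: cvgB; [exact: steps_fst|exact: cvg_cst].
  by apply: cvgM; [exact: steps_snd|exact: cvg_cst].
near=> q.
have q0 : 0 < q.2 by near: q; exact: steps_gt0.
have qr : `|q.1 - z| + q.2 * `|d| < r by near: q; exact: (cvgr_lt _ tr).
have inr (u : R) : 0 <= u <= q.2 -> differentiable psi (q.1 + u *: d) /\
    `|'D_d psi z - 'D_d psi (q.1 + u *: d)| <= e.
  move=> /andP[u0 uq]; apply: rP; rewrite /= distrC addrAC.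
  apply: le_lt_trans qr; apply: le_trans (ler_normD _ _) _; rewrite lerD2l.
  by rewrite normrZ ger0_norm// ler_wpM2r.
have [c /inr[_ cD'] E] := mvt_line psi q.1 d q.2 q0 (fun u uq => (inr u uq).1).
by rewrite /quotient E mulrAC divff ?mul1r// gt_eqF.
Unshelve. all: by end_near. Qed.

Lemma sderiv_derive psi z d a : derivable psi z d -> sderiv psi z d a ->
  a = 'D_d psi z.
Proof.
move=> dpsi pa.
have c1 : (fun t : R => quotient psi d (z, t)) @ (0 : R)^'+ --> a.
  move=> A /pa [[B1 B2] /= [zB B0] BA].
  by apply: filterS B0 => t Bt; apply: (BA (z, t)); split => //; exact: nbhs_singleton.
have c2 : (fun t : R => quotient psi d (z, t)) @ (0 : R)^'+ --> 'D_d psi z.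
  have -> : (fun t : R => quotient psi d (z, t)) =
      (fun h => h^-1 *: ((psi \o shift z) (h *: d) - psi z)).
    by apply/funext => t; rewrite /quotient /= mulrC (addrC z).
  exact: cvg_dnbhs_at_right.
exact: (cvg_unique _ c1 c2).
Qed.

Lemma sderiv_Ck1 psi z d : Ck 1 psi -> sderiv psi z d ('D_d psi z).
Proof.
move=> [dpsi cD]; apply: sderiv_C1; last exact: (cD d z).
by apply: (filterS (P := setT)) => [x _|]; [exact: dpsi|exact: filterT].
Qed.

Lemma dotp_grad psi z d : differentiable psi z -> dotp (grad psi z) d = 'D_d psi z.
Proof.
move=> dpsi; rewrite deriveE// {2}[d]row_sum_delta linear_sum.
by apply: eq_bigr => i _; rewrite linearZ /= !mxE deriveE// mulrC.
Qed.

Lemma dotp_mulmx {k} (l : 'rV[R]_k) (A : 'M[R]_(n, k)) d :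
  dotp (l *m A^T) d = dotp l (d *m A).
Proof.
have dotpE m (a b : 'rV[R]_m) : dotp a b = (a *m b^T) 0 0.
  by rewrite mxE; apply: eq_bigr => i _; rewrite mxE.
by rewrite !dotpE trmx_mul mulmxA.
Qed.

Lemma dotp_Dmx {k} (l : 'rV[R]_k) (h : 'rV[R]_n -> 'rV[R]_k) z d :
  differentiable h z -> dotp (l *m Dmx h z) d = dotp l ('D_d h z).
Proof. by move=> dh; rewrite dotp_mulmx deriveEjacobian. Qed.

Lemma derive_coord {k} (h : 'rV[R]_n -> 'rV[R]_k) z d j : derivable h z d ->
  'D_d (fun x => h x 0 j) z = 'D_d h z 0 j.
Proof. by move=> dh; rewrite (derive_mx dh) mxE. Qed.

Lemma differentiable_coord_comp {k} (h : 'rV[R]_n -> 'rV[R]_k) z j :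
  differentiable h z -> differentiable (fun x => h x 0 j) z.
Proof.
move=> dh; apply: (@differentiable_comp _ _ _ _ h (fun v : 'rV[R]_k => v 0 j)) => //.
exact: differentiable_coord.
Qed.

Lemma Ck_coord {k i} (h : 'rV[R]_n -> 'rV[R]_k) j :
  Ck i h -> Ck i (fun x => h x 0 j).
Proof.
elim: i h => [|i IH] h /=.
  by move=> ch z; exact: (cvg_coord _ _ j (ch z)).
move=> [dh Dh]; split => [z|v]; first exact: differentiable_coord_comp.
rewrite (_ : (fun z => _) = (fun z => 'D_v h z 0 j)); first exact: IH.
by apply/funext => z; rewrite derive_coord//; exact: diff_derivable.
Qed.

Lemma Ck_differentiable {k} {W : normedModType R} (h : 'rV[R]_n -> W) z :
  Ck k.+1 h -> differentiable h z.
Proof. by case. Qed.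

Lemma CkW {k} {W : normedModType R} (h : 'rV[R]_n -> W) : Ck k.+1 h -> Ck k h.
Proof.
elim: k h => [|k IH] h; move=> [dh Dh].
  by move=> z; exact: differentiable_continuous.
by split => // v; exact: IH.
Qed.

Lemma sderiv_coord_Ck1 {k} (h : 'rV[R]_n -> 'rV[R]_k) z d j : Ck 1 h ->
  sderiv (fun x => h x 0 j) z d ('D_d h z 0 j).
Proof.
move=> h1; rewrite -derive_coord; first exact/sderiv_Ck1/Ck_coord.
exact/diff_derivable/(Ck_differentiable _ _ h1).
Qed.

Lemma sum_grad_Dmx {k} (l : 'rV[R]_k) (h : 'rV[R]_n -> 'rV[R]_k) z :
  differentiable h z ->
  l *m Dmx h z = \sum_i l 0 i *: grad (fun x => h x 0 i) z.
Proof.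
move=> dh; apply: dotp_inj => d; rewrite dotp_Dmx// dotp_suml.
apply: eq_bigr => i _; rewrite dotpZl dotp_grad ?derive_coord//.
  exact: diff_derivable.
exact: differentiable_coord_comp.
Qed.

End continuously_differentiable.

(** * Differentiability of the lower-level stationarity map [H1] *)

Section lower_level_gradient.
Context {R : realType} {n m p : nat}.
Variables (f : 'rV[R]_(n + m) -> R) (g : 'rV[R]_(n + m) -> 'rV[R]_p).

Lemma differentiable_rV {N k} (h : 'rV[R]_N -> 'rV[R]_k) z :
  (forall j, differentiable (fun x => h x 0 j) z) -> differentiable h z.
Proof.
move=> dh.
have -> : h = \sum_(j < k) (fun x => h x 0 j *: delta_mx 0 j).
  by apply/funext => x; rewrite fct_sumE {1}[h x]row_sum_delta.
by apply: differentiable_sum => j; exact: differentiableZl.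
Qed.

Lemma H1_coord t j : H1 f g t 0 j =
  'D_(delta_mx 0 (rshift n j)) f (lsubmx t) +
  \sum_i rsubmx t 0 i * 'D_(delta_mx 0 (rshift n j)) (fun z => g z 0 i) (lsubmx t).
Proof.
rewrite /H1 /grad_y !mxE summxE; congr (_ + _).
by apply: eq_bigr => i _; rewrite !mxE.
Qed.

Lemma differentiable_H1 t : Ck 2 f -> Ck 2 g -> differentiable (H1 f g) t.
Proof.
move=> f2 g2; apply: differentiable_rV => j.
have dcomp (psi : 'rV[R]_(n + m) -> R) : Ck 1 psi ->
    differentiable (fun t : 'rV[R]_(n + m + p) => psi (lsubmx t)) t.
  move=> psi1; apply: (@differentiable_comp _ _ _ _ lsubmx psi).
    exact: differentiable_lsubmx.
  exact: (Ck_differentiable _ _ psi1).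
pose D (psi : 'rV[R]_(n + m) -> R) z := 'D_(delta_mx 0 (rshift n j)) psi z.
have -> : (fun x => H1 f g x 0 j) = (fun x => D f (lsubmx x)) +
    \sum_(i < p) (fun x => rsubmx x 0 i) * (fun x => D (fun z => g z 0 i) (lsubmx x)).
  by apply/funext => x; rewrite H1_coord /= [RHS]/GRing.add /= fct_sumE.
apply: differentiableD; first by apply: dcomp; exact: f2.2.
apply: differentiable_sum => i; apply: differentiableM.
  by apply: differentiable_coord_comp; exact: differentiable_rsubmx.
by apply: dcomp; exact: (Ck_coord (i := 2) g i g2).2.
Qed.

Lemma sderiv_lsubmx {N1 N2} (psi : 'rV[R]_N1 -> R) (z d : 'rV[R]_(N1 + N2)) a :
  sderiv psi (lsubmx z) (lsubmx d) a -> sderiv (fun x => psi (lsubmx x)) z d a.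
Proof. by apply: sderiv_comp_linear; exact: continuous_lsubmx. Qed.

Lemma sderiv_rsubmx {N1 N2} (psi : 'rV[R]_N2 -> R) (z d : 'rV[R]_(N1 + N2)) a :
  sderiv psi (rsubmx z) (rsubmx d) a -> sderiv (fun x => psi (rsubmx x)) z d a.
Proof. by apply: sderiv_comp_linear; exact: continuous_rsubmx. Qed.

(** The sum and product rules give some strict derivative; its value need not be computed, since a
    strict derivative agrees with the ordinary one. *)
Lemma sderiv_H1 t d j : Ck 2 f -> Ck 2 g ->
  sderiv (fun x => H1 f g x 0 j) t d ('D_d (H1 f g) t 0 j).
Proof.
move=> f2 g2; have dH := differentiable_H1 t f2 g2.
suff [a Sa] : exists a, sderiv (fun x => H1 f g x 0 j) t d a.
  have := sderiv_derive _ _ _ _ (diff_derivable (differentiable_coord_comp _ _ j dH)) Sa.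
  by rewrite derive_coord; [move=> <-|exact: diff_derivable].
pose D (psi : 'rV[R]_(n + m) -> R) z := 'D_(delta_mx 0 (rshift n j)) psi z.
have -> : (fun x => H1 f g x 0 j) = (fun x => D f (lsubmx x) +
    \sum_(i < p) rsubmx x 0 i * D (fun z => g z 0 i) (lsubmx x)).
  by apply/funext => x; rewrite H1_coord.
have g1 i : Ck 1 (D (fun z => g z 0 i)) by exact: (Ck_coord (i := 2) g i g2).2.
eexists; apply: sderivD; first exact/sderiv_lsubmx/sderiv_Ck1/f2.2.
apply: sderiv_sum => i; apply: sderivM.
- exact: (cvg_coord _ _ i (@continuous_rsubmx R 1 (n + m) p t)).
- apply: differentiable_continuous.
  apply: (@differentiable_comp _ _ _ _ lsubmx (D (fun z => g z 0 i))).
    exact: differentiable_lsubmx.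
  exact: (Ck_differentiable _ _ (g1 i)).
- by apply: (sderiv_rsubmx (fun v => v 0 i)); exact: sderiv_id.
- exact/sderiv_lsubmx/sderiv_Ck1.
Qed.

End lower_level_gradient.

(** * Normals to the complementarity set *)

Section complementarity.
Context {R : realType} {p m : nat}.
Variables (b1 b2 : pred 'I_p).
Implicit Types (k l : 'rV[R]_(p + p + m)).

Local Notation ka k := (lsubmx (lsubmx k)).
Local Notation kv k := (rsubmx (lsubmx k)).

(* The complementarity constraints on (g, u, H1), restricted to the branches
   g_j = 0 for j in b1 and u_j = 0 for j in b2. *)
Definition comp_set : set 'rV[R]_(p + p + m) :=
  [set k | rsubmx k = 0 /\ forall j,
    [/\ ka k 0 j <= 0, 0 <= kv k 0 j, ka k 0 j * kv k 0 j = 0,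
        b1 j -> ka k 0 j = 0 & b2 j -> kv k 0 j = 0]].

Lemma closed_comp_set : closed comp_set.
Proof.
move=> k; rewrite closureEcvg => -[G GP [Gk AG]].
have cl : (fun x : 'rV[R]_(p + p + m) => lsubmx x) @ G --> lsubmx k.
  exact: (cvg_comp _ _ Gk (@continuous_lsubmx R 1 _ _ k)).
have ca j := cvg_coord _ _ j (cvg_comp _ _ cl (@continuous_lsubmx R 1 _ _ _)).
have cv j := cvg_coord _ _ j (cvg_comp _ _ cl (@continuous_rsubmx R 1 _ _ _)).
have cr j := cvg_coord _ _ j (cvg_comp _ _ Gk (@continuous_rsubmx R 1 _ _ k)).
have lim0 (psi : 'rV[R]_(p + p + m) -> R) a : psi @ G --> a ->
    (forall x, comp_set x -> psi x = 0) -> a = 0.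
  move=> pa p0; have c0 : psi @ G --> (0 : R).
    by apply: cvg_near_cst; apply: AG => x /p0.
  exact: (cvg_unique _ pa c0).
split=> [|j].
  apply/rowP => j; rewrite [RHS]mxE.
  by apply: (lim0 _ _ (cr j)) => x [/= -> _]; rewrite mxE.
split.
- by apply: (cvgr_to_le (ca j)); apply: AG => x [_ /(_ j)[]].
- by apply: (cvgr_to_ge (cv j)); apply: AG => x [_ /(_ j)[]].
- by apply: (lim0 _ _ (cvgM (ca j) (cv j))) => x [_ /(_ j)[]].
- by move=> bj; apply: (lim0 _ _ (ca j)) => x [_ /(_ j)[_ _ _ /(_ bj)]].
- by move=> bj; apply: (lim0 _ _ (cv j)) => x [_ /(_ j)[_ _ _ _ /(_ bj)]].
Qed.

Lemma add_scale_delta {N} (v : 'rV[R]_N) (c : R) j i :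
  (v + c *: delta_mx 0 j) 0 i = v 0 i + c * (i == j)%:R.
Proof. by rewrite mxE [in X in _ + X]mxE [in X in _ * X]mxE eqxx. Qed.

(** The test direction moves only the [j]-th entry of the first block, with speed [s]; the
    assumptions are the constraints that this move can violate. *)
Lemma prox_normal_comp_a k l j s : prox_normal comp_set k l -> comp_set k ->
  (\forall t \near (0 : R)^'+,
    [/\ ka k 0 j + t * s <= 0, (ka k 0 j + t * s) * kv k 0 j = 0 &
       b1 j -> ka k 0 j + t * s = 0]) ->
  ka l 0 j * s <= 0.
Proof.
move=> pn [q0 Kk] Ht.
pose d : 'rV[R]_(p + p + m) := row_mx (row_mx (s *: delta_mx 0 j) 0) 0.
have -> : ka l 0 j * s = dotp l d.
  rewrite -{2}[l]hsubmxK -{2}[lsubmx l]hsubmxK !dotp_row_mx !dotp0r !addr0.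
  by rewrite dotpZr dotp_delta mulrC.
apply: (prox_normal_dir _ _ _ _ pn); apply: filterS Ht => t [t1 t2 t3].
have -> : k + t *: d = row_mx (row_mx (ka k + (t * s) *: delta_mx 0 j) (kv k)) (rsubmx k).
  rewrite -{1}[k]hsubmxK -{1}[lsubmx k]hsubmxK /d !scale_row_mx !add_row_mx.
  by rewrite !scaler0 !addr0 scalerA.
split; first by rewrite row_mxKr.
move=> i; rewrite row_mxKl row_mxKl row_mxKr; have [k1 k2 k3 k4 k5] := Kk i.
rewrite add_scale_delta; have [->|ij] := eqVneq i j.
  by have [? ? ? ? ?] := Kk j; rewrite mulr1; split.
by rewrite mulr0 addr0; split.
Qed.

Lemma prox_normal_comp_v k l j s : prox_normal comp_set k l -> comp_set k ->
  (\forall t \near (0 : R)^'+,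
    [/\ 0 <= kv k 0 j + t * s, ka k 0 j * (kv k 0 j + t * s) = 0 &
       b2 j -> kv k 0 j + t * s = 0]) ->
  kv l 0 j * s <= 0.
Proof.
move=> pn [q0 Kk] Ht.
pose d : 'rV[R]_(p + p + m) := row_mx (row_mx 0 (s *: delta_mx 0 j)) 0.
have -> : kv l 0 j * s = dotp l d.
  rewrite -{2}[l]hsubmxK -{2}[lsubmx l]hsubmxK !dotp_row_mx !dotp0r addr0 add0r.
  by rewrite dotpZr dotp_delta mulrC.
apply: (prox_normal_dir _ _ _ _ pn); apply: filterS Ht => t [t1 t2 t3].
have -> : k + t *: d = row_mx (row_mx (ka k) (kv k + (t * s) *: delta_mx 0 j)) (rsubmx k).
  rewrite -{1}[k]hsubmxK -{1}[lsubmx k]hsubmxK /d !scale_row_mx !add_row_mx.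
  by rewrite !scaler0 !addr0 scalerA.
split; first by rewrite row_mxKr.
move=> i; rewrite row_mxKl row_mxKl row_mxKr; have [k1 k2 k3 k4 k5] := Kk i.
rewrite add_scale_delta; have [->|ij] := eqVneq i j.
  by have [? ? ? ? ?] := Kk j; rewrite mulr1; split.
by rewrite mulr0 addr0; split.
Qed.

Lemma near0_lt (a s : R) : a < 0 -> \forall t \near (0 : R)^'+, a + t * s < 0.
Proof.
move=> a0; have c : (fun t : R => a + t * s) @ (0 : R)^'+ --> a + 0 * s.
  apply: cvgD; first exact: cvg_cst.
  by apply: cvgM; [exact: cvg_right_id|exact: cvg_cst].
by apply: (cvgr_lt _ c); rewrite mul0r addr0.
Qed.

(** An inactive entry can move both ways, which forces its multiplier to vanish. An entry whose
    partner is 0 and which is not pinned by its branch can move into its own feasible half-line,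
    which fixes a sign. *)
Lemma prox_normal_comp k l j : prox_normal comp_set k l -> comp_set k ->
  [/\ ka k 0 j < 0 -> ka l 0 j = 0,
      0 < kv k 0 j -> kv l 0 j = 0,
      ~~ b1 j -> kv k 0 j = 0 -> 0 <= ka l 0 j
    & ~~ b2 j -> ka k 0 j = 0 -> kv l 0 j <= 0].
Proof.
move=> pn Kk; have [_ /(_ j) [k1 k2 k3 k4 k5]] := Kk.
have pa s := prox_normal_comp_a k l j s pn Kk.
have pv s := prox_normal_comp_v k l j s pn Kk.
split.
- move=> a0; have v0 : kv k 0 j = 0.
    by apply/eqP; move/eqP: k3; rewrite mulf_eq0 lt_eqF.
  have H s : ka l 0 j * s <= 0.
    apply: pa; apply: filterS (near0_lt _ s a0) => t H; rewrite v0 mulr0.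
    by split => //; [exact: ltW|move=> /k4 ka0; rewrite ka0 ltxx in a0].
  by have := H 1; have := H (-1); lra.
- move=> v0; have a0 : ka k 0 j = 0.
    by apply/eqP; move/eqP: k3; rewrite mulf_eq0 (gt_eqF v0) orbF.
  have nv0 : - kv k 0 j < 0 by lra.
  have H s : kv l 0 j * s <= 0.
    apply: pv; apply: filterS (near0_lt _ (- s) nv0) => t H; rewrite a0 mul0r.
    by split => //; [lra|move=> /k5 ka0; rewrite ka0 ltxx in v0].
  by have := H 1; have := H (-1); lra.
- move=> nb v0; suff : ka l 0 j * (-1) <= 0 by lra.
  apply: pa; near=> t.
  have t0 : 0 < t by near: t; exact: nbhs_right_gt.
  by rewrite v0 mulr0; split => //; [lra|move: nb => /negbTE ->].
- move=> nb a0; suff : kv l 0 j * 1 <= 0 by lra.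
  apply: pv; near=> t.
  have t0 : 0 < t by near: t; exact: nbhs_right_gt.
  by rewrite a0 mul0r; split => //; [lra|move: nb => /negbTE ->].
Unshelve. all: by end_near. Qed.

(** Nearby base points may be biactive or lie on either branch, whence the alternative of
    M-stationarity. A branch that pins exactly one entry to 0 keeps it 0 at the nearby points, so
    the sign for the other entry persists. *)
Lemma limiting_normal_comp k l : limiting_normal comp_set k l -> forall j,
  [/\ ka k 0 j < 0 -> ka l 0 j = 0,
      0 < kv k 0 j -> kv l 0 j = 0,
      ~~ b1 j -> ~~ b2 j -> (0 < ka l 0 j /\ kv l 0 j < 0) \/ ka l 0 j * kv l 0 j = 0,
      ~~ b1 j -> b2 j -> 0 <= ka l 0 j
    & b1 j -> ~~ b2 j -> kv l 0 j <= 0].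
Proof.
move=> kl j.
have lim e : 0 < e -> exists k' l', [/\ `|ka k' 0 j - ka k 0 j| < e,
   `|kv k' 0 j - kv k 0 j| < e, `|ka l' 0 j - ka l 0 j| < e,
   `|kv l' 0 j - kv l 0 j| < e & comp_set k' /\ prox_normal comp_set k' l'].
  move=> e0; have [k' [l' [kk ll Kk' pn]]] := limiting_normalP _ _ _ _ kl e0.
  exists k', l'; have aux (x y : 'rV[R]_(p + p + m)) : `|x - y| < e ->
      `|ka x 0 j - ka y 0 j| < e /\ `|kv x 0 j - kv y 0 j| < e.
    have -> : ka x 0 j - ka y 0 j = ka (x - y) 0 j by rewrite !linearB !mxE.
    have -> : kv x 0 j - kv y 0 j = kv (x - y) 0 j by rewrite !linearB !mxE.
    move=> xy; split; apply: le_lt_trans xy; apply: le_trans (normr_coord_le _ _) _.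
      exact: le_trans (norm_lsubmx_le _) (norm_lsubmx_le _).
    exact: le_trans (norm_rsubmx_le _) (norm_lsubmx_le _).
  by have [? ?] := aux _ _ kk; have [? ?] := aux _ _ ll.
have small (x : R) : (forall e, 0 < e -> `|x| < e) -> x = 0.
  move=> H; apply/eqP; apply: contraT => x0.
  by have := H `|x|; rewrite normr_gt0 x0 ltxx => /(_ isT).
split.
- move=> a0; apply: small => e e0.
  have [|k' [l' [ha _ hl _ [Kk' pn]]]] := lim (Num.min e (- ka k 0 j)).
    by rewrite lt_min e0 oppr_gt0.
  have [/(_ _)H _ _ _] := prox_normal_comp _ _ j pn Kk'.
  move: hl; rewrite H ?sub0r ?normrN ?lt_min; first by case/andP.
  by move: ha; rewrite lt_min => /andP[_]; rewrite ltr_norml; lra.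
- move=> a0; apply: small => e e0.
  have [|k' [l' [_ ha _ hl [Kk' pn]]]] := lim (Num.min e (kv k 0 j)).
    by rewrite lt_min e0.
  have [_ /(_ _)H _ _] := prox_normal_comp _ _ j pn Kk'.
  move: hl; rewrite H ?sub0r ?normrN ?lt_min; first by case/andP.
  by move: ha; rewrite lt_min => /andP[_]; rewrite ltr_norml; lra.
- move=> nb1 nb2.
  have [a0|an0] := eqVneq (ka l 0 j) 0; first by right; rewrite a0 mul0r.
  have [v0|vn0] := eqVneq (kv l 0 j) 0; first by right; rewrite v0 mulr0.
  (* This close, both entries of [l'] are nonzero too. Hence neither entry of [k'] is inactive: [k']
     is biactive at [j] and both signs apply. *)
  left; have [|k' [l' [_ _ ha hv [Kk' pn]]]] := lim (Num.min `|ka l 0 j| `|kv l 0 j|).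
    by rewrite lt_min !normr_gt0 an0.
  move: ha hv; rewrite !lt_min => /andP[ha _] /andP[_ hv].
  have [Ha Hv Ga Gv] := prox_normal_comp _ _ j pn Kk'.
  have [_ /(_ j) [k1 k2 k3 k4 k5]] := Kk'.
  have a'0 : ka k' 0 j = 0.
    apply/eqP; rewrite eq_le k1 leNgt; apply/negP => /Ha al.
    by rewrite al sub0r normrN ltxx in ha.
  have v'0 : kv k' 0 j = 0.
    apply/eqP; rewrite eq_le k2 andbT leNgt; apply/negP => /Hv vl.
    by rewrite vl sub0r normrN ltxx in hv.
  have {}Ga := Ga nb1 v'0; have {}Gv := Gv nb2 a'0.
  split.
    rewrite lt_def an0 leNgt; apply/negP => al.
    by move: ha; rewrite (ltr0_norm al) ltr_norml; lra.
  rewrite lt_def eq_sym vn0 leNgt; apply/negP => al.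
  by move: hv; rewrite (gtr0_norm al) ltr_norml; lra.
- move=> nb1 jb2; rewrite leNgt; apply/negP => al.
  have [|k' [l' [_ _ ha hv [Kk' pn]]]] := lim (- ka l 0 j); first by lra.
  have [_ _ /(_ nb1)Ga _] := prox_normal_comp _ _ j pn Kk'.
  have [_ /(_ j) [_ _ _ _ /(_ jb2) v0]] := Kk'.
  by have := Ga v0; move: ha; rewrite ltr_norml; lra.
- move=> jb1 nb2; rewrite leNgt; apply/negP => al.
  have [|k' [l' [_ _ ha hv [Kk' pn]]]] := lim (kv l 0 j); first by lra.
  have [_ _ _ /(_ nb2)Ga] := prox_normal_comp _ _ j pn Kk'.
  have [_ /(_ j) [_ _ _ /(_ jb1) v0 _]] := Kk'.
  by have := Ga v0; move: hv; rewrite ltr_norml; lra.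
Qed.

End complementarity.

(** * Lipschitz functions and the Clarke gradient *)

Section clarke_gradient.
Context {R : realType} {n : nat}.
Implicit Types (phi : 'rV[R]_n -> \bar R) (x v : 'rV[R]_n).

Lemma lipschitz_nearP phi x : lipschitz_near phi x ->
  exists r K, [/\ 0 < r, 0 <= K & forall z z', `|z - x| < r -> `|z' - x| < r ->
    phi z \is a fin_num /\ `|fine (phi z) - fine (phi z')| <= K * `|z - z'|].
Proof.
move=> [A [/nbhs_normP[r /= r0 rA] Afin Alip]]; exists r.
have [K] := filter_ex (filterI (nbhs_pinfty_ge (num_real (0 : R))) Alip).
move=> [K0 lipK]; exists K; split => // z z' zr z'r.
have Az : A z by apply: rA; rewrite /= distrC.
have Az' : A z' by apply: rA; rewrite /= distrC.
by split; [exact: Afin|exact: (lipK (z, z'))].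
Qed.

(** The limsup is an infimum of suprema over members [A] of the filter. A supremum [+oo] is
    harmless, [-oo] is excluded as [A] is nonempty, and a finite one is an admissible [a]. *)
Lemma le_clarke_dd (h : 'rV[R]_n -> R) x v c :
  (forall a, (\forall q \near steps x, h (q.1 + q.2 *: v) - h q.1 <= q.2 * a) ->
     c <= a) ->
  (c%:E <= clarke_dd h x v)%E.
Proof.
move=> H; rewrite /clarke_dd limf_esupE; apply: le_ereal_inf_tmp => /= _ [A FA <-].
set S := ereal_sup _.
have ub q : A q -> ((quotient h v q)%:E <= S)%E.
  by move=> Aq; apply: ereal_sup_ubound; exists q.
case: S ub => [a| |] ub; last 2 first.
- by rewrite leey.
- have [q Aq] := @filter_ex _ _ (steps_proper x) _ FA.
  by have := ub q Aq; rewrite leeNy_eq.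
rewrite lee_fin; apply: H; near=> q.
have q0 : 0 < q.2 by near: q; exact: steps_gt0.
rewrite -ler_pdivrMl// mulrC -/(quotient h v q) -lee_fin; apply: ub.
by near: q.
Unshelve. all: by end_near. Qed.

Lemma sderiv_le_clarke_dd (h : 'rV[R]_n -> R) x v c : sderiv h x v c ->
  (c%:E <= clarke_dd h x v)%E.
Proof.
move=> hc; apply: le_clarke_dd => a Ha; apply: (cvgr_to_le hc); near=> q.
have q0 : 0 < q.2 by near: q; exact: steps_gt0.
rewrite /quotient ler_pdivrMr// mulrC.
by near: q.
Unshelve. all: by end_near. Qed.

Lemma C1_near_sderiv phi x v : C1_near phi x ->
  sderiv (fine \o phi) x v ('D_v (fine \o phi) x).
Proof.
move=> C1; have [_ _ Dc] := nbhs_singleton C1.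
by apply: sderiv_C1; [apply: filterS C1 => z []|exact: Dc].
Qed.

(** The finitely many partial derivatives are bounded near [x] by continuity at [x]; the mean value
    theorem on a ball, which contains the segment between any two of its points, does the rest. *)
Lemma C1_near_lipschitz phi x : C1_near phi x -> lipschitz_near phi x.
Proof.
move=> C1; pose h := fine \o phi.
have [_ _ Dc] := nbhs_singleton C1.
have bD : \forall z \near x, forall i : 'I_n,
    `|'D_(delta_mx 0 i) h z| <= `|grad h x| + 1.
  apply: (@filter_forall _ _ (fun i z => `|'D_(delta_mx 0 i) h z| <= `|grad h x| + 1)
    (nbhs x) _) => i.
  have : \forall z \near x, `|'D_(delta_mx 0 i) h x - 'D_(delta_mx 0 i) h z| <= 1.
    by have /cvgrPdist_le := Dc (delta_mx 0 i); apply.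
  apply: filterS => z; rewrite distrC => Hz.
  rewrite -(subrK ('D_(delta_mx 0 i) h x) ('D_(delta_mx 0 i) h z)).
  rewrite (le_trans (ler_normD _ _))// addrC lerD//.
  by have := normr_coord_le (grad h x) i; rewrite mxE.
have /nbhs_normP[r /= r0 rP] : \forall z \near x,
    [/\ phi z \is a fin_num, differentiable h z &
      forall i : 'I_n, `|'D_(delta_mx 0 i) h z| <= `|grad h x| + 1].
  by apply: filterS2 C1 bD => z [? ? ?] ?.
pose K : R := n%:R * (`|grad h x| + 1).
exists [set z | `|x - z| < r]; split.
- by have := nbhs_dist_lt x r r0; apply: filterS => z; rewrite distrC.
- by move=> z /rP[].
suff lip : forall z z', `|x - z| < r -> `|x - z'| < r ->
    `|h z - h z'| <= K * `|z - z'|.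
  rewrite /lipschitz_on; near=> M => -[z z'] /= [zr z'r].
  rewrite -[_ <= _]/(`|h z - h z'| <= M * `|z - z'|); apply: le_trans (lip _ _ zr z'r) _.
  rewrite ler_wpM2r//; near: M; apply: nbhs_pinfty_ge; exact: num_real.
move=> z z' zr z'r.
have inr u : 0 <= u <= 1 -> `|x - (z' + u *: (z - z'))| < r.
  move=> /andP[u0 u1].
  have -> : x - (z' + u *: (z - z')) = (1 - u) *: (x - z') + u *: (x - z).
    by apply/rowP => i; rewrite !mxE; ring.
  apply: le_lt_trans (ler_normD _ _) _.
  rewrite !normrZ (ger0_norm u0) ger0_norm ?subr_ge0//.
  have [->|u0'] := eqVneq u 0; first by rewrite subr0 mul1r mul0r addr0.
  have : u * `|x - z| < u * r by rewrite ltr_pM2l// lt_def u0'.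
  have : (1 - u) * `|x - z'| <= (1 - u) * r by rewrite ler_wpM2l ?subr_ge0// ltW.
  by lra.
have [c c01] := mvt_line h z' (z - z') 1 ltr01
  (fun u u01 => let: And3 _ d _ := rP _ (inr u u01) in d).
rewrite scale1r (addrC z') subrK mul1r => ->.
have [_ dh bh] := rP _ (inr c c01).
rewrite -dotp_grad//; apply: le_trans (dotp_le_norm _ _) _.
rewrite /K -mulrA ler_wpM2l// ler_wpM2r//.
by apply: rV_norm_le => [|i]; [rewrite addr_ge0|rewrite mxE].
Unshelve. all: by end_near. Qed.

Lemma C1_near_clarke_grad phi x : C1_near phi x ->
  clarke_grad phi x (grad (fine \o phi) x).
Proof.
move=> C1; split; first exact: C1_near_lipschitz.
move=> v; have [_ dx _] := nbhs_singleton C1.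
by rewrite dotp_grad//; exact/sderiv_le_clarke_dd/C1_near_sderiv.
Qed.

End clarke_gradient.

(** * Fritz John conditions for the constraints of (GCP) *)

Section gcp_multipliers.
Context {R : realType} {n m p l s : nat}.
Variables (f : 'rV[R]_(n + m) -> R) (g : 'rV[R]_(n + m) -> 'rV[R]_p).
Variables (H2 : 'rV[R]_(n + m + p + l) -> 'rV[R]_s) (C : set 'rV[R]_s).
Hypotheses (f2 : Ck 2 f) (g2 : Ck 2 g) (H2_1 : Ck 1 H2).
Implicit Types (z d : 'rV[R]_(n + m + p + l)).

Local Notation XY z := (lsubmx (lsubmx z)).
Local Notation U z := (rsubmx (lsubmx z)).

Lemma quadK z : quad (lsubmx (XY z)) (rsubmx (XY z)) (U z) (rsubmx z) = z.
Proof. by rewrite /quad /triple !hsubmxK. Qed.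

Definition gcp_map z : 'rV[R]_(p + p + m) :=
  row_mx (row_mx (g (XY z)) (U z)) (H1 f g (lsubmx z)).

Definition gcp_map_derive z d : 'rV[R]_(p + p + m) :=
  row_mx (row_mx ('D_(XY d) g (XY z)) (U d)) ('D_(lsubmx d) (H1 f g) (lsubmx z)).

(** The adjoint of the constraint derivatives applied to the multipliers. Here [nu] belongs to [u]
    itself, so it is minus the [lu] of the stationarity conditions. *)
Definition multiplier_gradient z (lg nu : 'rV[R]_p) (l1 : 'rV[R]_m)
    (l2 : 'rV[R]_s) : 'rV[R]_(n + m + p + l) :=
  row_mx (row_mx (lg *m Dmx g (XY z)) nu) 0 +
  row_mx (l1 *m Dmx (H1 f g) (lsubmx z)) 0 + l2 *m Dmx H2 z.

Lemma sderiv_gcp_map z d j :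
  sderiv (fun x => gcp_map x 0 j) z d (gcp_map_derive z d 0 j).
Proof.
rewrite /gcp_map /gcp_map_derive -[j]splitK; case: (fintype.split j) => i /=; last first.
  under eq_fun do rewrite row_mxEr.
  by rewrite row_mxEr; apply: (sderiv_lsubmx (fun t => H1 f g t 0 i)); exact: sderiv_H1.
rewrite row_mxEl; under eq_fun do rewrite row_mxEl.
rewrite -[i]splitK; case: (fintype.split i) => i' /=.
  under eq_fun do rewrite row_mxEl.
  rewrite row_mxEl; apply: (sderiv_lsubmx (fun t => g (lsubmx t) 0 i')).
  apply: (sderiv_lsubmx (fun t => g t 0 i')); apply: sderiv_coord_Ck1.
  exact: CkW.
under eq_fun do rewrite row_mxEr.
rewrite row_mxEr; apply: (sderiv_lsubmx (fun t => rsubmx t 0 i')).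
by apply: (sderiv_rsubmx (fun v => v 0 i')); exact: sderiv_id.
Qed.

Lemma continuous_gcp_map : continuous gcp_map.
Proof.
have cl : continuous (fun z => lsubmx z : 'rV[R]_(n + m + p)).
  exact: continuous_lsubmx.
move=> z; apply: (continuous_row_mx_comp (fun z => row_mx (g (XY z)) (U z))
  (fun z => H1 f g (lsubmx z)) z).
  apply: (continuous_row_mx_comp (fun z => g (XY z)) (fun z => U z) z).
    apply: (@continuous_comp _ _ _ lsubmx (fun t => g (lsubmx t))); first exact: cl.
    apply: (@continuous_comp _ _ _ lsubmx g); first exact: continuous_lsubmx.
    exact/differentiable_continuous/(Ck_differentiable _ _ g2).
  by apply: (@continuous_comp _ _ _ lsubmx rsubmx); [exact: cl|exact: continuous_rsubmx].
apply: (@continuous_comp _ _ _ lsubmx (H1 f g)); first exact: cl.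
exact/differentiable_continuous/differentiable_H1.
Qed.

Lemma dotp_multiplier_gradient z lg nu l1 l2 d :
  dotp (multiplier_gradient z lg nu l1 l2) d =
  dotp (row_mx (row_mx lg nu) l1) (gcp_map_derive z d) + dotp l2 ('D_d H2 z).
Proof.
rewrite !dotpDl !dotp_Dmx; last exact: (Ck_differentiable _ _ H2_1).
have row0 (a : 'rV[R]_(n + m + p)) :
    dotp (row_mx a (0 : 'rV[R]_l)) d = dotp a (lsubmx d).
  by rewrite -{1}[d]hsubmxK dotp_row_mx dotp0l addr0.
rewrite !row0 /gcp_map_derive -{1}[lsubmx d]hsubmxK.
rewrite (dotp_row_mx (lg *m Dmx g (XY z))) dotp_Dmx; last first.
  exact: (Ck_differentiable _ _ g2).
rewrite dotp_Dmx; last exact: differentiable_H1.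
by rewrite (dotp_row_mx (row_mx lg nu)) (dotp_row_mx lg).
Qed.

Lemma comp_set_gcp_map (b1 b2 : pred 'I_p) z : comp_set b1 b2 (gcp_map z) <->
  [/\ forall j, g (XY z) 0 j <= 0, forall j, 0 <= U z 0 j,
      forall j, U z 0 j * g (XY z) 0 j = 0, H1 f g (lsubmx z) = 0 &
      (forall j, b1 j -> g (XY z) 0 j = 0) /\ (forall j, b2 j -> U z 0 j = 0)].
Proof.
rewrite /comp_set /gcp_map /= row_mxKr row_mxKl row_mxKl row_mxKr; split.
  move=> [h1 H]; split => // [j|j|j|]; last by split => j; case: (H j).
  - by case: (H j).
  - by case: (H j).
  - by rewrite mulrC; case: (H j).
move=> [H1' H2' H3' H4 [H5 H6]]; split => // j; split => //.
- by rewrite mulrC.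
- exact: H5.
- exact: H6.
Qed.

Lemma dotp_sign_eq0 {k} (u v : 'rV[R]_k) : (forall j, v 0 j <= 0) ->
  (forall j, 0 <= u 0 j) -> dotp u v = 0 <-> (forall j, u 0 j * v 0 j = 0).
Proof.
move=> v0 u0; split=> [uv j|uv]; last by apply: big1 => j _.
have /eqP : \sum_(i < k) - (u 0 i * v 0 i) = 0.
  by rewrite sumrN -/(dotp u v) uv oppr0.
rewrite psumr_eq0 => [/allP/(_ j)|i _]; last by rewrite -mulrN mulr_ge0// oppr_ge0.
by rewrite mem_index_enum /= oppr_eq0 => /(_ isT)/eqP.
Qed.

Lemma comp_set_feasible (b1 b2 : pred 'I_p) z : comp_set b1 b2 (gcp_map z) -> C (H2 z) ->
  feasible_GCPmu f g H2 C (lsubmx (XY z)) (rsubmx (XY z)) (U z) (rsubmx z).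
Proof.
move=> /comp_set_gcp_map[h1 h2 h3 h4 _] Cz.
split; rewrite ?quadK /triple ?hsubmxK//.
by apply/dotp_sign_eq0.
Qed.

Lemma feasible_comp_set (b1 b2 : pred 'I_p) z :
  feasible_GCPmu f g H2 C (lsubmx (XY z)) (rsubmx (XY z)) (U z) (rsubmx z) ->
  (forall j, b1 j -> g (XY z) 0 j = 0) -> (forall j, b2 j -> U z 0 j = 0) ->
  comp_set b1 b2 (gcp_map z) /\ C (H2 z).
Proof.
rewrite /feasible_GCPmu quadK /triple !hsubmxK => -[h1 h2 h3 h4 h5] e1 e2.
by split => //; apply/comp_set_gcp_map; split => //; apply/dotp_sign_eq0.
Qed.

(** The branch is left open: [pred0] twice gives the full complementarity set for part (a),
    complementary predicates give the two branches for part (b). *)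
Lemma gcp_fritz_john (b1 b2 : pred 'I_p)
    (phi h0 : 'rV[R]_(n + m + p + l) -> R) (Dphi : 'rV[R]_(n + m + p + l) -> R)
    zb (r : R) :
  0 < r -> convex_set C -> comp_set b1 b2 (gcp_map zb) -> C (H2 zb) ->
  h0 zb <= 0 ->
  (forall z, `|z - zb| <= r -> {for z, continuous phi} /\ {for z, continuous h0}) ->
  (forall z, `|z - zb| <= r -> h0 z <= 0 -> comp_set b1 b2 (gcp_map z) ->
     C (H2 z) -> phi zb <= phi z) ->
  (forall d, sderiv phi zb d (Dphi d)) ->
  (forall d, exists L, \forall q \near steps zb,
     `|h0 (q.1 + q.2 *: d) - h0 q.1| <= L * q.2) ->
  exists (l0 lf : R) (lg nu : 'rV[R]_p) (l1 : 'rV[R]_m) (l2 : 'rV[R]_s),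
  [/\ [/\ 0 <= l0, 0 <= lf, 0 <= lf * h0 zb &
          l0 + lf + `|row_mx (row_mx (row_mx lg nu) l1) l2| = 1],
      normal_cone C (H2 zb) l2 /\ (forall j,
      [/\ g (XY zb) 0 j < 0 -> lg 0 j = 0,
          0 < U zb 0 j -> nu 0 j = 0,
          ~~ b1 j -> ~~ b2 j -> (0 < lg 0 j /\ nu 0 j < 0) \/ lg 0 j * nu 0 j = 0,
          ~~ b1 j -> b2 j -> 0 <= lg 0 j
        & b1 j -> ~~ b2 j -> nu 0 j <= 0]),
      forall d a, (\forall q \near steps zb,
         h0 (q.1 + q.2 *: d) - h0 q.1 <= q.2 * a) ->
         0 <= l0 * Dphi d + lf * a + dotp (multiplier_gradient zb lg nu l1 l2) d
    & forall mu, 0 <= mu ->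
        (forall z k c, `|z - zb| <= r -> `|k - gcp_map zb| <= r ->
           `|c - H2 zb| <= r -> comp_set b1 b2 k -> C c ->
           phi zb <= phi z + mu * (Num.max (h0 z) 0 +
             `|row_mx (gcp_map z - k) (H2 z - c)|)) ->
        1 <= l0 * (1 + 4 * mu)].
Proof.
move=> r0 cvxC Kb Cb h0b cont locmin Sphi Lh0.
have [|l0 [lf [l' [l2 [[l0ge lfge sum1 slack] [nl nC] stat calm]]]]] :=
  fritz_john phi h0 gcp_map H2 (comp_set b1 b2) C zb Dphi
    (gcp_map_derive zb) (fun d => 'D_d H2 zb) r r0
    (closed_comp_set _ _) Kb cvxC Cb h0b _ locmin Sphi
    (sderiv_gcp_map zb) (fun d j => sderiv_coord_Ck1 H2 zb d j H2_1) Lh0.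
  move=> z /cont[cz c0]; split; [exact: cz|exact: c0|exact: continuous_gcp_map|].
  exact/differentiable_continuous/(Ck_differentiable _ _ H2_1).
exists l0, lf, (lsubmx (lsubmx l')), (rsubmx (lsubmx l')), (rsubmx l'), l2.
split => //.
- by split => //; rewrite !hsubmxK.
- split => // j; have := limiting_normal_comp _ _ _ _ nl j.
  by rewrite /gcp_map !row_mxKl row_mxKr.
- by move=> d a up; rewrite dotp_multiplier_gradient !hsubmxK; exact: stat.
Qed.

End gcp_multipliers.

(** * Multipliers under MPEC LICQ *)

Section strong_stationarity.
Context {R : realType} {n m p l s : nat}.
Variables (f : 'rV[R]_(n + m) -> R) (g : 'rV[R]_(n + m) -> 'rV[R]_p).
Variables (H2 : 'rV[R]_(n + m + p + l) -> 'rV[R]_s) (C : set 'rV[R]_s).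
Hypotheses (f2 : Ck 2 f) (g2 : Ck 2 g) (H2_1 : Ck 1 H2).
Implicit Types (z d : 'rV[R]_(n + m + p + l)).

Local Notation XY z := (lsubmx (lsubmx z)).
Local Notation U z := (rsubmx (lsubmx z)).
Local Notation MG := (multiplier_gradient f g H2).

Lemma multiplier_gradientP z a lg nu l1 l2 lg' nu' l1' l2' :
  MG z (a *: lg + lg') (a *: nu + nu') (a *: l1 + l1') (a *: l2 + l2') =
  a *: MG z lg nu l1 l2 + MG z lg' nu' l1' l2'.
Proof.
apply: dotp_inj => d; rewrite [RHS]dotpDl dotpZl !dotp_multiplier_gradient//.
by rewrite -!add_row_mx -!scale_row_mx !dotpDl !dotpZl; ring.
Qed.

Lemma multiplier_gradientZ z a lg nu l1 l2 :
  MG z (a *: lg) (a *: nu) (a *: l1) (a *: l2) = a *: MG z lg nu l1 l2.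
Proof.
have := multiplier_gradientP z a lg nu l1 l2 0 0 0 0; rewrite !addr0 => ->.
by rewrite {2}/multiplier_gradient !mul0mx !row_mx0 !addr0.
Qed.

Lemma normal_coneZ (c : 'rV[R]_s) (k : R) v :
  normal_cone C c v -> 0 <= k -> normal_cone C c (k *: v).
Proof.
move=> [Cc nv] k0; split => // c' Cc'.
by rewrite dotpZl mulr_ge0_le0// nv.
Qed.

(** The weights of an affine combination must sum to 1; since 0 is a normal, it can absorb the
    missing weight of the difference. *)
Lemma normal_cone_hull (c v v' : 'rV[R]_s) : normal_cone C c v ->
  normal_cone C c v' -> affine_hull (normal_cone C c) (- v + v').
Proof.
move=> nv nv'; have n0 : normal_cone C c 0.
  by split; [case: nv|move=> c' _; rewrite dotp0l].
exists 3%N, (fun i => [:: -1; 1; 1]`_i), (fun i => [:: v; v'; 0]`_i); split.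
- by move=> [[|[|[|i]]] Hi].
- by rewrite !big_ord_recl big_ord0 /=; ring.
- by rewrite !big_ord_recl big_ord0 /= scaleN1r !scale1r !addr0.
Qed.

Lemma affine_hull_sub (S : set 'rV[R]_s) : S `<=` affine_hull S.
Proof.
move=> v Sv; exists 1%N, (fun=> 1), (fun=> v); split => //.
  by rewrite big_ord1.
by rewrite big_ord1 scale1r.
Qed.

(** LICQ sums over index sets, while the multipliers here are full vectors that vanish off those
    sets. At a complementary point the second index set is just the set where [u] vanishes. *)
Lemma MPEC_LICQ_multipliers z (lg nu : 'rV[R]_p) (l1 : 'rV[R]_m) (l2 : 'rV[R]_s) :
  MPEC_LICQ f g H2 C (lsubmx (XY z)) (rsubmx (XY z)) (U z) (rsubmx z) ->
  (forall j, g (XY z) 0 j <= 0) -> (forall j, 0 <= U z 0 j) ->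
  (forall j, U z 0 j * g (XY z) 0 j = 0) ->
  (forall j, g (XY z) 0 j < 0 -> lg 0 j = 0) ->
  (forall j, 0 < U z 0 j -> nu 0 j = 0) ->
  MG z lg nu l1 l2 = 0 -> affine_hull (normal_cone C (H2 z)) l2 ->
  [/\ lg = 0, nu = 0, l1 = 0 & l2 = 0].
Proof.
move=> licq gz uz ugz lg0 nu0 mg0 al2.
have zc j : (Iu g (lsubmx (XY z)) (rsubmx (XY z)) (U z) j ||
    I0 g (lsubmx (XY z)) (rsubmx (XY z)) (U z) j) = (U z 0 j == 0).
  rewrite /Iu /I0 /= hsubmxK; have := gz j; rewrite le_eqVlt.
  by case/orP => [/eqP ->|gl]; rewrite ?eqxx ?ltxx //= gl (lt_eqF gl) /= orbF.
have [||lg1 nu1 -> ->] := licq lg (- nu) l1 l2.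
- rewrite quadK /triple !hsubmxK -[LHS]mg0 /multiplier_gradient.
  congr (_ + _); congr (_ + _).
  rewrite (_ : \sum_(j | _) _ *: delta_mx 0 j = - nu); last first.
    rewrite [RHS]row_sum_delta [RHS](bigID (fun j => U z 0 j == 0))/=.
    rewrite [X in _ = _ + X]big1 => [|j u0].
      by rewrite addr0; apply: eq_bigl => j; rewrite zc.
    by rewrite mxE nu0 ?oppr0 ?scale0r// lt_def u0 uz.
  have -> : \sum_(j | J0 g (lsubmx (XY z)) (rsubmx (XY z)) j)
      lg 0 j *: row_mx (row_mx (grad (fun x : 'rV[R]_(n + m) => g x 0 j) (XY z))
        (0 : 'rV[R]_p)) (0 : 'rV[R]_l) =
      row_mx (row_mx (lg *m Dmx g (XY z)) 0) 0.
    pose inj (v : 'rV[R]_(n + m)) := row_mx (row_mx v (0 : 'rV[R]_p)) (0 : 'rV[R]_l).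
    have injD v w : inj (v + w) = inj v + inj w by rewrite /inj !add_row_mx !addr0.
    have inj0 : inj 0 = 0 by rewrite /inj !row_mx0.
    rewrite sum_grad_Dmx; last exact: (Ck_differentiable _ _ g2).
    rewrite -/(inj _) (big_morph inj injD inj0) big_mkcond; apply: eq_bigr => j _.
    case: ifP => [_|]; first by rewrite /inj !scale_row_mx !scaler0.
    rewrite /J0 /= hsubmxK => /negbT g0.
    by rewrite lg0 ?scale0r ?inj0// lt_def eq_sym g0 gz.
  by rewrite !opp_row_mx !add_row_mx !oppr0 opprK !addr0 add0r.
- by rewrite quadK.
split => //; apply/rowP => j; rewrite [RHS]mxE.
  have [g0|g0] := eqVneq (g (XY z) 0 j) 0.
    by apply: lg1; rewrite /J0 /= hsubmxK g0.
  by apply: lg0; rewrite lt_def eq_sym g0 gz.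
have [u0|u0] := eqVneq (U z 0 j) 0.
  by have := nu1 j; rewrite zc u0 eqxx mxE => /(_ isT)/eqP; rewrite oppr_eq0 => /eqP.
by apply: nu0; rewrite lt_def u0 uz.
Qed.

Section local_minimum.
Variables (phi : 'rV[R]_(n + m + p + l) -> R) (zb G : 'rV[R]_(n + m + p + l)) (r : R).
Hypotheses (r0 : 0 < r) (cvxC : convex_set C).
Hypothesis feas :
  feasible_GCPmu f g H2 C (lsubmx (XY zb)) (rsubmx (XY zb)) (U zb) (rsubmx zb).
Hypothesis cphi : forall z, `|z - zb| <= r -> {for z, continuous phi}.
Hypothesis locmin : forall z, `|z - zb| <= r ->
  feasible_GCPmu f g H2 C (lsubmx (XY z)) (rsubmx (XY z)) (U z) (rsubmx z) ->
  phi zb <= phi z.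
Hypothesis Sphi : forall d, sderiv phi zb d (dotp G d).
Hypothesis licq :
  MPEC_LICQ f g H2 C (lsubmx (XY zb)) (rsubmx (XY zb)) (U zb) (rsubmx zb).

Let feasE : [/\ forall j, g (XY zb) 0 j <= 0, forall j, 0 <= U zb 0 j,
  forall j, U zb 0 j * g (XY zb) 0 j = 0 & C (H2 zb)].
Proof.
have [h1 h2 h3 _ h5] := feas; rewrite quadK hsubmxK in h1 h3 h5.
by split => //; apply/dotp_sign_eq0.
Qed.

(* MPEC LICQ rules out an abnormal multiplier. *)
Lemma branch_multipliers (b1 b2 : pred 'I_p) :
  (forall j, b1 j -> g (XY zb) 0 j = 0) -> (forall j, b2 j -> U zb 0 j = 0) ->
  exists (lg nu : 'rV[R]_p) (l1 : 'rV[R]_m) (l2 : 'rV[R]_s),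
  [/\ G + MG zb lg nu l1 l2 = 0,
      normal_cone C (H2 zb) l2,
      forall j, g (XY zb) 0 j < 0 -> lg 0 j = 0,
      forall j, 0 < U zb 0 j -> nu 0 j = 0
    & forall j, (~~ b1 j -> b2 j -> 0 <= lg 0 j) /\
                (b1 j -> ~~ b2 j -> nu 0 j <= 0)].
Proof.
move=> e1 e2; have [gz uz ugz Cz] := feasE.
have [Kb _] := feasible_comp_set f g H2 C b1 b2 zb feas e1 e2.
(* (GCP_mu) has no value function constraint, so [h0] is the constant -1; the slackness condition
   [0 <= lf * h0 zb] then yields [lf = 0]. *)
have [||||l0 [lf [lg [nu [l1 [l2 [[l0ge lfge slack sum1] [nl2 cs] stat _]]]]]]] :=
  gcp_fritz_john f g H2 C f2 g2 H2_1 b1 b2 phi (cst (-1)) (fun d => dotp G d)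
    zb r r0 cvxC Kb Cz _ _ _ Sphi _.
- by rewrite /cst lerN10.
- by move=> z zr; split; [exact: cphi|exact: (@cvg_cst _ _ _ (nbhs z) _)].
- by move=> z zr _ Kz /(comp_set_feasible f g H2 C b1 b2 z Kz); exact: locmin.
- move=> d; exists 0; apply: steps_all => q.
  by rewrite /cst subrr normr0 mul0r.
have lf0 : lf = 0 by rewrite /cst in slack; lra.
have eqG : l0 *: G + MG zb lg nu l1 l2 = 0.
  apply: dotp_ge0_eq0 => d; have := stat d 0.
  rewrite mulr0 addr0 (dotpDl (l0 *: G)) dotpZl; apply.
  by apply: steps_all => q; rewrite /cst subrr mulr0.
have lgz j : g (XY zb) 0 j < 0 -> lg 0 j = 0 by case: (cs j).
have nuz j : 0 < U zb 0 j -> nu 0 j = 0 by case: (cs j).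
have l0p : 0 < l0.
  rewrite lt_def l0ge andbT; apply/eqP => l00.
  rewrite l00 scale0r add0r in eqG.
  have [lg0 nu0 l10 l20] := MPEC_LICQ_multipliers _ _ _ _ _ licq gz uz ugz lgz nuz eqG
    (affine_hull_sub _ _ nl2).
  move: sum1; rewrite l00 lf0 lg0 nu0 l10 l20 !row_mx0 normr0 !addr0 => /eqP.
  by rewrite eq_sym oner_eq0.
have ip : 0 < l0^-1 by rewrite invr_gt0.
exists (l0^-1 *: lg), (l0^-1 *: nu), (l0^-1 *: l1), (l0^-1 *: l2); split.
- rewrite multiplier_gradientZ.
  by rewrite -[G](scalerK (lt0r_neq0 l0p)) -scalerDr eqG scaler0.
- by apply: normal_coneZ => //; exact: ltW.
- by move=> j /lgz; rewrite mxE => ->; rewrite mulr0.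
- by move=> j /nuz; rewrite mxE => ->; rewrite mulr0.
- move=> j; have [_ _ _ c1 c2] := cs j; rewrite !mxE; split => h1 h2.
    by rewrite mulr_ge0 ?(ltW ip)// c1.
  by rewrite mulr_ge0_le0 ?(ltW ip)// c2.
Qed.

(* The multipliers of the two extreme branches coincide by MPEC LICQ, and each
   branch provides one of the two signs on I0. *)
Lemma strong_multipliers : exists (lg nu : 'rV[R]_p) (l1 : 'rV[R]_m) (l2 : 'rV[R]_s),
  [/\ G + MG zb lg nu l1 l2 = 0,
      normal_cone C (H2 zb) l2,
      forall j, g (XY zb) 0 j < 0 -> lg 0 j = 0,
      forall j, 0 < U zb 0 j -> nu 0 j = 0
    & forall j, g (XY zb) 0 j = 0 -> U zb 0 j = 0 -> 0 <= lg 0 j /\ nu 0 j <= 0].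
Proof.
have [gz uz ugz Cz] := feasE.
pose b1 j := g (XY zb) 0 j == 0; pose b2 j := U zb 0 j == 0.
have nb1 j : ~~ b1 j -> U zb 0 j = 0.
  by rewrite /b1 => /negbTE h; apply/eqP; have /eqP := ugz j; rewrite mulf_eq0 h orbF.
have nb2 j : ~~ b2 j -> g (XY zb) 0 j = 0.
  by rewrite /b2 => /negbTE h; apply/eqP; have /eqP := ugz j; rewrite mulf_eq0 h.
(* This branch pins [g] on all active indices and leaves [u] free on I0, giving the sign of [nu];
   the next one does the reverse and gives the sign of [lg']. *)
have [|lg [nu [l1 [l2 [E nl2 c1 c2 c3]]]]] := branch_multipliers b1 (predC b1) _ nb1.
  by move=> j /eqP.
have [|lg' [nu' [l1' [l2' [E' nl2' c1' c2' c3']]]]] := branch_multipliers (predC b2) b2 nb2.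
  by move=> j /eqP.
(* Both branches have the objective gradient [G] with weight 1, so the difference of the multipliers
   solves the homogeneous system of LICQ. *)
have D : MG zb (-1 *: lg + lg') (-1 *: nu + nu') (-1 *: l1 + l1') (-1 *: l2 + l2') = 0.
  rewrite multiplier_gradientP scaleN1r.
  have := subrr (0 : 'rV[R]_(n + m + p + l)).
  by rewrite -{1}E' -E opprD addrACA subrr add0r addrC.
have [||| lgE _ _ _] := MPEC_LICQ_multipliers _ _ _ _ _ licq gz uz ugz _ _ D.
- by move=> j h; rewrite !mxE c1 ?c1'// mulr0 addr0.
- by move=> j h; rewrite !mxE c2 ?c2'// mulr0 addr0.
- by rewrite scaleN1r; exact: normal_cone_hull.
exists lg, nu, l1, l2; split => // j g0 u0; split.
  have -> : lg = lg' by apply/esym/eqP; rewrite -subr_eq0 addrC -scaleN1r lgE.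
  by have [+ _] := c3' j; apply; rewrite /= /b2 u0 eqxx.
by have [_] := c3 j; apply; rewrite /= /b1 g0 eqxx.
Qed.

End local_minimum.

End strong_stationarity.

(** * S-stationarity from partial calmness *)

Section problem.
Context {R : realType} {n m p l s : nat}.
Variables (F f : 'rV[R]_(n + m) -> R) (g : 'rV[R]_(n + m) -> 'rV[R]_p).
Variables (H2 : 'rV[R]_(n + m + p + l) -> 'rV[R]_s) (C : set 'rV[R]_s).
Hypotheses (F1 : Ck 1 F) (f2 : Ck 2 f) (g2 : Ck 2 g) (H2_1 : Ck 1 H2).
Hypothesis (cvxC : convex_set C).
Implicit Types (z d : 'rV[R]_(n + m + p + l)).

Local Notation XY z := (lsubmx (lsubmx z)).
Local Notation X z := (lsubmx (XY z)).
Local Notation Y z := (rsubmx (XY z)).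
Local Notation U z := (rsubmx (lsubmx z)).
Local Notation MG := (multiplier_gradient f g H2).

Definition embed_XY (v : 'rV[R]_(n + m)) : 'rV[R]_(n + m + p + l) :=
  row_mx (row_mx v 0) 0.

Lemma dotp_embed_XY v d : dotp (embed_XY v) d = dotp v (XY d).
Proof.
rewrite -{1}[d]hsubmxK -{1}[lsubmx d]hsubmxK !dotp_row_mx.
by rewrite !dotp0l !addr0.
Qed.

Lemma embed_XYP a v w : embed_XY (a *: v + w) = a *: embed_XY v + embed_XY w.
Proof.
by apply: dotp_inj => d; rewrite dotpDl dotpZl !dotp_embed_XY dotpDl dotpZl.
Qed.

Lemma enorm_lt_radius {N} (e : R) : 0 < e ->
  exists2 r, 0 < r & forall v : 'rV[R]_N, `|v| <= r -> enorm v < e.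
Proof.
move=> e0; exists (e / (2 * N.+1%:R)); first by rewrite divr_gt0// mulr_gt0.
move=> v vr; apply: le_lt_trans (enorm_le_norm v) _.
have : N.+1%:R * `|v| <= N.+1%:R * (e / (2 * N.+1%:R)) by rewrite ler_wpM2l.
have -> : N.+1%:R * (e / (2 * N.+1%:R)) = e / 2 by field.
by lra.
Qed.

Lemma continuous_XY (psi : 'rV[R]_(n + m) -> R) z : Ck 1 psi ->
  {for z, continuous (fun z => psi (XY z))}.
Proof.
move=> psi1.
apply: (@continuous_comp _ _ _ lsubmx (fun t => psi (lsubmx t))).
  exact: continuous_lsubmx.
apply: (@continuous_comp _ _ _ lsubmx psi); first exact: continuous_lsubmx.
exact/differentiable_continuous/(Ck_differentiable _ _ psi1).
Qed.

Lemma sderiv_XY (psi : 'rV[R]_(n + m) -> R) z d : Ck 1 psi ->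
  sderiv (fun z => psi (XY z)) z d (dotp (embed_XY (grad psi (XY z))) d).
Proof.
move=> psi1; rewrite dotp_embed_XY dotp_grad; last exact: (Ck_differentiable _ _ psi1).
apply: (sderiv_lsubmx (fun t => psi (lsubmx t))); apply: sderiv_lsubmx.
exact: sderiv_Ck1.
Qed.

Lemma lipschitz_ball_continuous (h : 'rV[R]_n -> R) (x a : 'rV[R]_n) (r K : R) :
  0 <= K ->
  (forall a b, `|a - x| < r -> `|b - x| < r -> `|h a - h b| <= K * `|a - b|) ->
  `|a - x| < r -> {for a, continuous h}.
Proof.
move=> K0 lip ar; apply/(@cvgrPdist_le _ _ _ (nbhs a)) => e e0.
have n1 : \forall y \near a, `|y - a| < r - `|a - x|.
  by apply: nbhs_dist_lt; rewrite subr_gt0.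
have n2 : \forall y \near a, `|y - a| < e / (K + 1).
  by apply: nbhs_dist_lt; rewrite divr_gt0//; lra.
apply: filterS2 n1 n2 => y y1 y2.
have yr : `|y - x| < r.
  rewrite -(subrK a y) -addrA (le_lt_trans (ler_normD _ _))//.
  by rewrite -ltrBrDr.
apply: le_trans (lip _ _ ar yr) _.
rewrite distrC; apply: le_trans (_ : K * (e / (K + 1)) <= _).
  by rewrite ler_wpM2l// ltW.
have D : 0 < K + 1 by lra.
by rewrite mulrCA ler_piMr ?(ltW e0)// ler_pdivrMr// mul1r; lra.
Qed.

Lemma lipschitz_near_continuous (phi : 'rV[R]_n -> \bar R) (x : 'rV[R]_n) (r K : R) :
  0 <= K ->
  (forall a b, `|a - x| < r -> `|b - x| < r ->
    phi a \is a fin_num /\ `|fine (phi a) - fine (phi b)| <= K * `|a - b|) ->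
  forall z, `|X z - x| < r -> {for z, continuous (fun z => fine (phi (X z)))}.
Proof.
move=> K0 lip z zr.
apply: (@continuous_comp _ _ _ lsubmx (fun t => fine (phi (lsubmx (lsubmx t))))).
  exact: continuous_lsubmx.
apply: (@continuous_comp _ _ _ lsubmx (fun t => fine (phi (lsubmx t)))).
  exact: continuous_lsubmx.
apply: (@continuous_comp _ _ _ lsubmx (fine \o phi)); first exact: continuous_lsubmx.
apply: (lipschitz_ball_continuous _ x _ r K K0 _ zr) => a b ar br.
by have [] := lip a b ar br.
Qed.

Lemma norm_X_le z z' : `|X z - X z'| <= `|z - z'|.
Proof.
rewrite -!linearB; apply: le_trans (norm_lsubmx_le _) _.
exact: le_trans (norm_lsubmx_le _) (norm_lsubmx_le _).
Qed.

Lemma subGCP_le0 (a : R) (v : \bar R) : v \is a fin_num ->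
  ((a%:E - v <= 0)%E : bool) = (a - fine v <= 0).
Proof. by case: v => // r _; rewrite -EFinB lee_fin. Qed.

Lemma stationarity_equation z (t : 'rV[R]_(n + m)) (lg nu : 'rV[R]_p)
    (l1 : 'rV[R]_m) (l2 : 'rV[R]_s) :
  embed_XY (grad F (XY z) + t) + MG z lg nu l1 l2 = 0 ->
  0 = row_mx (row_mx (grad F (XY z) + t + lg *m Dmx g (XY z)) 0) 0
      - row_mx (row_mx 0 (- nu)) 0
      + row_mx (l1 *m Dmx (H1 f g) (lsubmx z)) 0 + l2 *m Dmx H2 z.
Proof.
move=> <-; rewrite /embed_XY /multiplier_gradient !addrA.
congr (_ + _ + _).
by rewrite !opp_row_mx !add_row_mx !oppr0 opprK !addr0 add0r.
Qed.

(** Partial calmness moves [f - V] into the objective. The cases [mu = 0] and [V] smooth differ only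
    in the real-valued objective [phi] and its gradient, so both reduce to [strong_multipliers]. *)
Lemma partially_calm_S_stationary (zb : 'rV[R]_(n + m + p + l)) (mu : R) :
  feasible_GCP f g H2 C (X zb) (Y zb) (U zb) (rsubmx zb) ->
  partially_calm_with F f g H2 C mu (X zb) (Y zb) (U zb) (rsubmx zb) ->
  mu = 0 \/ C1_near (value f g) (X zb) ->
  MPEC_LICQ f g H2 C (X zb) (Y zb) (U zb) (rsubmx zb) ->
  S_stationary F f g H2 C (X zb) (Y zb) (U zb) (rsubmx zb).
Proof.
move=> feas [mu0 [feasmu [eps eps0 opt]]] muC licq.
have [r1 r1p r1P] := @enorm_lt_radius (n + m + p + l) eps eps0.
suff [t tV [phi [r [rp cphi locmin Sphi]]]] : exists2 t : 'rV[R]_(n + m),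
    value_term f g mu (X zb) (Y zb) t &
    exists phi r, [/\ 0 < r,
      forall z, `|z - zb| <= r -> {for z, continuous phi},
      forall z, `|z - zb| <= r ->
        feasible_GCPmu f g H2 C (X z) (Y z) (U z) (rsubmx z) -> phi zb <= phi z
      & forall d, sderiv phi zb d (dotp (embed_XY (grad F (XY zb) + t)) d)].
  have [lg [nu [l1 [l2 [E nl2 c1 c2 c3]]]]] := strong_multipliers f g H2 C f2 g2 H2_1
    phi zb _ r rp cvxC feasmu cphi locmin Sphi licq.
  split => //; exists mu, lg, (- nu), l1, l2; split => //.
  - exists t => //; have := stationarity_equation zb t lg nu l1 l2 E.
    by rewrite quadK /triple !hsubmxK.
  - split.
    + by move=> j /andP[]; rewrite hsubmxK => /c1.
    + by move=> j /andP[_] /c2; rewrite mxE => ->; rewrite oppr0.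
    + by rewrite quadK.
  - move=> j /andP[]; rewrite hsubmxK => /eqP g0 /eqP u0.
    by have [? ?] := c3 j g0 u0; rewrite mxE oppr_ge0.
(* For [mu = 0] the values of [V] may be infinite, but [0 * _] is 0 in the extended reals and [phi]
   is just [F]. *)
have [mu00|mun0] := eqVneq mu 0.
  exists 0; first by left.
  exists (fun z => F (XY z)), r1; split => //.
  - by move=> z _; exact: continuous_XY.
  - move=> z zr fz; have := opt (X z) (Y z) (U z) (rsubmx z).
    by rewrite !quadK mu00 !mul0e !adde0 lee_fin !hsubmxK; apply => //; exact: r1P.
  - by move=> d; rewrite addr0; exact: sderiv_XY.
have C1 : C1_near (value f g) (X zb) by case: muC => // /eqP; rewrite (negbTE mun0).
have [r2 [K [r2p K0 lip]]] := lipschitz_nearP _ _ (C1_near_lipschitz _ _ C1).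
pose V := fine \o value f g.
exists (mu *: (grad f (XY zb) - row_mx (grad V (X zb)) 0)).
  right; split; first exact/eqP.
  by exists (grad V (X zb)); [exact: C1_near_clarke_grad|rewrite hsubmxK].
exists (fun z => F (XY z) + mu * (f (XY z) + (-1) * V (X z))), (Num.min r1 (r2 / 2)).
have inr z : `|z - zb| <= Num.min r1 (r2 / 2) -> `|X z - X zb| < r2.
  rewrite le_min => /andP[_ zr]; apply: le_lt_trans (norm_X_le _ _) _.
  by apply: le_lt_trans zr _; lra.
have Xb : `|X zb - X zb| < r2 by rewrite subrr normr0.
split => //.
- by rewrite lt_min r1p divr_gt0.
- move=> z /inr zr.
  apply: (@cvgD _ _ _ (nbhs z) _ (fun z => F (XY z))).
    exact: (continuous_XY _ z F1).
  apply: (@cvgM _ _ (nbhs z) _ (cst mu)); first exact: (@cvg_cst _ _ _ (nbhs z) _).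
  apply: (@cvgD _ _ _ (nbhs z) _ (fun z => f (XY z))).
    exact: (continuous_XY _ z (CkW _ f2)).
  apply: (@cvgM _ _ (nbhs z) _ (cst (-1))); first exact: (@cvg_cst _ _ _ (nbhs z) _).
  exact: (lipschitz_near_continuous (value f g) (X zb) r2 K K0 lip z zr).
- move=> z zr fz; have zr2 := inr z zr.
  have [Vz _] := lip _ _ zr2 Xb; have [Vb _] := lip _ _ Xb Xb.
  have := opt (X z) (Y z) (U z) (rsubmx z); rewrite !quadK !hsubmxK /V /=.
  rewrite -(fineK Vz) -(fineK Vb) /= -!EFinB -!EFinM -!EFinD lee_fin !mulN1r.
  by apply => //; apply: r1P; move: zr; rewrite le_min => /andP[].
- move=> d.
  have -> : dotp (embed_XY (grad F (XY zb) +
      mu *: (grad f (XY zb) - row_mx (grad V (X zb)) 0))) d =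
      dotp (embed_XY (grad F (XY zb))) d + mu * (dotp (embed_XY (grad f (XY zb))) d +
        (-1) * dotp (grad V (X zb)) (X d)).
    rewrite !dotp_embed_XY dotpDl dotpZl dotpBl -{3}[XY d]hsubmxK dotp_row_mx dotp0l.
    by rewrite addr0 mulN1r.
  apply: sderivD; first exact: sderiv_XY.
  apply: sderivZ; apply: sderivD; first exact/sderiv_XY/CkW.
  apply: sderivZ; rewrite dotp_grad; last by have [] := nbhs_singleton C1.
  apply: (sderiv_lsubmx (fun t => V (lsubmx (lsubmx t)))).
  apply: (sderiv_lsubmx (fun t => V (lsubmx t))).
  apply: (sderiv_lsubmx V); exact: C1_near_sderiv.
Qed.

End problem.

(** * M-stationarity from Clarke calmness *)

Section clarke_calmness.
Context {R : realType} {n m p l s : nat}.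
Variables (F f : 'rV[R]_(n + m) -> R) (g : 'rV[R]_(n + m) -> 'rV[R]_p).
Variables (H2 : 'rV[R]_(n + m + p + l) -> 'rV[R]_s) (C : set 'rV[R]_s).
Hypotheses (F1 : Ck 1 F) (f2 : Ck 2 f) (g2 : Ck 2 g) (H2_1 : Ck 1 H2).
Hypothesis (cvxC : convex_set C).
Implicit Types (z d : 'rV[R]_(n + m + p + l)).

Local Notation XY z := (lsubmx (lsubmx z)).
Local Notation X z := (lsubmx (XY z)).
Local Notation Y z := (rsubmx (XY z)).
Local Notation U z := (rsubmx (lsubmx z)).
Local Notation MG := (multiplier_gradient f g H2).
Local Notation V := (fine \o value f g).
Local Notation gap := (fun z => f (XY z) - V (X z)).

(** The step of [- V] along [d] is read backwards, as a step of [V] along [- X d] from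
    [X (q.1 + q.2 *: d)]. This moving base point still tends to [X zb], so the strict bound on [V]
    applies. *)
Lemma gap_increment zb d a e : 0 < e ->
  (\forall q \near steps (X zb), V (q.1 + q.2 *: - X d) - V q.1 <= q.2 * a) ->
  \forall q \near steps zb, gap (q.1 + q.2 *: d) - gap q.1 <=
    q.2 * (dotp (embed_XY (l := l) (p := p) (grad f (XY zb))) d + e + a).
Proof.
move=> e0 Va; have sf := sderiv_le_near _ _ _ _ _ (sderiv_XY f zb d (CkW _ f2)) e0.
have c1 : (fun q : 'rV[R]_(n + m + p + l) * R => X (q.1 + q.2 *: d)) @ steps zb --> X zb.
  have c0 := steps_shift zb d.
  have c1 := cvg_comp _ _ c0 (@continuous_lsubmx R 1 _ _ zb).
  have c2 := cvg_comp _ _ c1 (@continuous_lsubmx R 1 _ _ (lsubmx zb)).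
  exact: (cvg_comp _ _ c2 (@continuous_lsubmx R 1 _ _ (XY zb))).
have c2 : (fun q : 'rV[R]_(n + m + p + l) * R => q.2) @ steps zb --> (0 : R)^'+.
  exact: (@cvg_snd _ _ (nbhs zb)).
have c : (fun q : 'rV[R]_(n + m + p + l) * R => (X (q.1 + q.2 *: d), q.2)) @ steps zb
    --> steps (X zb) by exact: (cvg_pair c1 c2).
apply: filterS2 sf (c _ Va) => q /= sq.
have EX : X (q.1 + q.2 *: d) + q.2 *: - X d = X q.1.
  by rewrite !linearD !linearZ /= scalerN addrK.
rewrite EX => Vq.
have := le_trans (ler_norm _) sq.
by move: Vq; rewrite /=; lra.
Qed.

Lemma gap_lipschitz zb d (r K : R) : 0 < r -> 0 <= K ->
  (forall a b, `|a - X zb| < r -> `|b - X zb| < r -> `|V a - V b| <= K * `|a - b|) ->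
  exists L, \forall q \near steps zb, `|gap (q.1 + q.2 *: d) - gap q.1| <= L * q.2.
Proof.
move=> r0 K0 lip; pose c := dotp (embed_XY (l := l) (p := p) (grad f (XY zb))) d.
exists (`|c| + 1 + K * `|d|).
have sf := sderiv_le_near _ _ _ _ _ (sderiv_XY f zb d (CkW _ f2)) ltr01.
near=> q; have q0 : 0 < q.2 by near: q; exact: steps_gt0.
have q1 : `|X q.1 - X zb| < r.
  apply: le_lt_trans (norm_X_le _ _) _.
  by near: q; exact: (cvgr_distC_lt _ _ (steps_fst zb) r r0).
have q2 : `|X (q.1 + q.2 *: d) - X zb| < r.
  apply: le_lt_trans (norm_X_le _ _) _.
  by near: q; exact: (cvgr_distC_lt _ _ (steps_shift zb d) r r0).
have Vq := lip _ _ q2 q1.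
have dq : K * `|X (q.1 + q.2 *: d) - X q.1| <= K * (q.2 * `|d|).
  rewrite ler_wpM2l//; apply: le_trans (norm_X_le _ _) _.
  by rewrite addrAC subrr add0r normrZ gtr0_norm.
have fq : `|f (XY (q.1 + q.2 *: d)) - f (XY q.1) - q.2 * c| <= q.2 * 1 by near: q.
have fq' : `|f (XY (q.1 + q.2 *: d)) - f (XY q.1)| <= q.2 * `|c| + q.2.
  rewrite -(subrK (q.2 * c) (f (XY (q.1 + q.2 *: d)) - f (XY q.1))).
  apply: le_trans (ler_normD _ _) _; rewrite addrC normrM (gtr0_norm q0) lerD2l.
  by rewrite mulr1 in fq.
rewrite (_ : _ - _ = (f (XY (q.1 + q.2 *: d)) - f (XY q.1)) -
  (V (X (q.1 + q.2 *: d)) - V (X q.1))); last by ring.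
apply: le_trans (ler_normB _ _) _.
rewrite (_ : (_ + _) * _ = q.2 * `|c| + q.2 + K * (q.2 * `|d|)); last by ring.
exact: lerD fq' (le_trans Vq dq).
Unshelve. all: by end_near. Qed.

Lemma perturbation_norm_le (r1 : R) (r2 r3 : 'rV[R]_p) (P1 : 'rV[R]_m)
    (P2 : 'rV[R]_s) (e : R) : `|r1| <= e -> `|row_mx (row_mx (row_mx r2 r3) P1) P2| <= e ->
  perturbation_norm r1 r2 r3 P1 P2 <= (1 + p + p + m + s).+1%:R * e.
Proof.
rewrite !norm_row_mx_le => r1e /andP[/andP[/andP[r2e r3e] P1e] P2e].
rewrite /perturbation_norm; apply: le_trans (enorm_le_norm _) _.
rewrite ler_wpM2l// !norm_row_mx_le r2e r3e P1e P2e !andbT.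
apply: rV_norm_le => [|i]; first exact: le_trans r1e.
by rewrite mxE ord1 eqxx mulr1n.
Qed.

(** Any [z] near [zb] is feasible for a suitable perturbed problem whose perturbation is exactly the
    residual with respect to the chosen [k] and [c]; calmness then bounds the loss in [F] by that
    residual. *)
Lemma clarke_calm_penalty zb (r0 : R) : 0 < r0 ->
  (forall z, `|z - zb| < r0 -> value f g (X z) \is a fin_num) ->
  {for zb, continuous gap} -> gap zb <= 0 ->
  clarke_calm F f g H2 C (X zb) (Y zb) (U zb) (rsubmx zb) ->
  exists r mu, [/\ 0 < r, 0 <= mu & forall z k c,
    `|z - zb| <= r -> `|k - gcp_map f g zb| <= r -> `|c - H2 zb| <= r ->
    comp_set pred0 pred0 k -> C c ->
    F (XY zb) <= F (XY z) + mu * (Num.max (gap z) 0 +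
      `|row_mx (gcp_map f g z - k) (H2 z - c)|)].
Proof.
move=> r00 Vfin cgap gap0 [eps [mu [eps0 mu0 calm]]].
have [r1 r1p r1P] := @enorm_lt_radius R (n + m + p + l) eps eps0.
pose N : R := (1 + p + p + m + s).+1%:R.
have N0 : 0 < N by rewrite ltr0n.
(* Below, the gap part is at most [e] and the remaining residual at most [2 * e], so the
   perturbation norm is at most [N * (3 * e)], three quarters of [eps]. *)
pose e := eps / (4 * N).
have e0 : 0 < e by rewrite divr_gt0// mulr_gt0.
have n1 : \forall z \near zb, gap z < e.
  by apply: (cvgr_lt _ cgap); apply: le_lt_trans e0.
have n2 : \forall z \near zb, `|gcp_map f g z - gcp_map f g zb| < e.
  by apply: (cvgr_distC_lt _ _ (continuous_gcp_map f g f2 g2 zb)).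
have n3 : \forall z \near zb, `|H2 z - H2 zb| < e.
  have cH2 : {for zb, continuous H2}.
    exact/differentiable_continuous/(Ck_differentiable _ _ H2_1).
  by apply: (cvgr_distC_lt _ _ cH2).
have /nbhs_normP[r2 /= r2p r2P] : \forall z \near zb,
    [/\ gap z < e, `|gcp_map f g z - gcp_map f g zb| < e & `|H2 z - H2 zb| < e].
  by apply: filterS3 n1 n2 n3.
exists (Num.min (Num.min r1 (r2 / 2)) (Num.min e (r0 / 2))), (mu * N); split.
- by rewrite !lt_min r1p divr_gt0// e0 divr_gt0.
- by rewrite mulr_ge0// ltW.
move=> z k c; rewrite !le_min => /andP[/andP[z1 z2] /andP[_ z3]].
move=> /andP[_ /andP[ke _]] /andP[_ /andP[ce _]] Kk Cc.
have [gz hz Hz] : [/\ gap z < e, `|gcp_map f g z - gcp_map f g zb| < e &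
    `|H2 z - H2 zb| < e].
  by apply: r2P; rewrite /= distrC; apply: le_lt_trans z2 _; lra.
have Vz : value f g (X z) \is a fin_num by apply: Vfin; apply: le_lt_trans z3 _; lra.
have [k0 Kk'] := Kk.
pose a := Num.max (gap z) 0; pose b := `|row_mx (gcp_map f g z - k) (H2 z - c)|.
have a0 : 0 <= a by rewrite le_max lexx orbT.
have b0 : 0 <= b by exact: normr_ge0.
have ae : a <= e by rewrite ge_max (ltW gz) ltW.
have be : b <= 2 * e.
  rewrite norm_row_mx_le; apply/andP; split.
    rewrite -(subrK (gcp_map f g zb) (gcp_map f g z)) -addrA.
    apply: le_trans (ler_normD _ _) _; move: ke hz; rewrite (distrC k); lra.
  rewrite -(subrK (H2 zb) (H2 z)) -addrA.
  apply: le_trans (ler_normD _ _) _; move: ce Hz; rewrite (distrC c); lra.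
(* With these perturbations the complementarity pair at [z] becomes the pair of blocks of [k], the
   second negated, [H1] is cancelled, and [H2 z] is moved to [c]. *)
pose r2' : 'rV[R]_p := g (XY z) - lsubmx (lsubmx k).
pose r3' : 'rV[R]_p := U z - rsubmx (lsubmx k).
pose P1 : 'rV[R]_m := - H1 f g (lsubmx z); pose P2 := c - H2 z.
have pn : perturbation_norm (- a) r2' r3' P1 P2 <= N * (a + b).
  apply: perturbation_norm_le.
    by rewrite normrN ger0_norm// lerDl.
  have : b <= a + b by rewrite lerDr.
  rewrite /b -{1}[k]hsubmxK -{1}[lsubmx k]hsubmxK k0 /gcp_map.
  rewrite !opp_row_mx !add_row_mx subr0 !norm_row_mx_le /r2' /r3' /P1 /P2 normrN.
  by rewrite (distrC c).
have pne : perturbation_norm (- a) r2' r3' P1 P2 < eps.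
  apply: le_lt_trans pn _; apply: le_lt_trans (_ : N * (3 * e) < _).
    by rewrite ler_wpM2l ?(ltW N0)//; lra.
  rewrite /e (_ : N * _ = eps * (3 / 4)); last by field; rewrite gt_eqF.
  lra.
have := calm (- a) r2' r3' P1 P2 pne (X z) (Y z) (U z) (rsubmx z).
rewrite !quadK !hsubmxK /perturbed_feasible /triple !hsubmxK quadK => /(_ (r1P _ z1)).
have pf : [/\ ((f (XY z))%:E - value f g (X z) + (- a)%:E <= 0)%E,
   OmegaCS (g (XY z) - r2') (- U z + r3'), H1 f g (lsubmx z) + P1 = 0 & C (H2 z + P2)].
  split.
  - rewrite -(fineK Vz) -EFinB lee_fin subr_le0 /a.
    by rewrite le_max lexx.
  - rewrite /r2' /r3' subKr addrA addNr add0r; split.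
    + by move=> j; have [] := Kk' j.
    + by move=> j; rewrite mxE oppr_le0; have [] := Kk' j.
    + apply: big1 => j _; rewrite [W in _ * W]mxE mulrN.
      by have [_ _ -> _ _] := Kk' j; rewrite oppr0.
  - by rewrite subrr.
  - by rewrite addrC subrK.
move=> /(_ pf) cz.
have : mu * perturbation_norm (- a) r2' r3' P1 P2 <= mu * (N * (a + b)) by rewrite ler_wpM2l.
by rewrite -mulrA -/a -/b; lra.
Qed.

Lemma clarke_calm_M_stationary zb :
  local_solution_GCP F f g H2 C (X zb) (Y zb) (U zb) (rsubmx zb) ->
  lipschitz_near (value f g) (X zb) ->
  clarke_calm F f g H2 C (X zb) (Y zb) (U zb) (rsubmx zb) ->
  M_stationary F f g H2 C (X zb) (Y zb) (U zb) (rsubmx zb).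
Proof.
move=> [feas [eps eps0 opt]] lipV calm.
have [r1 r1p r1P] := @enorm_lt_radius R (n + m + p + l) eps eps0.
have [r2 [K [r2p K0 lip]]] := lipschitz_nearP _ _ lipV.
have Xb : `|X zb - X zb| < r2 by rewrite subrr normr0.
have inr z : `|z - zb| < r2 -> `|X z - X zb| < r2.
  by apply: le_lt_trans; exact: norm_X_le.
have Vfin z : `|z - zb| < r2 -> value f g (X z) \is a fin_num.
  by move=> /inr zr; have [] := lip _ _ zr Xb.
have cgap z : `|z - zb| < r2 -> {for z, continuous gap}.
  move=> /inr zr; apply: (@cvgB _ _ _ (nbhs z) _ (fun z => f (XY z))).
    exact: (continuous_XY f z (CkW _ f2)).
  exact: (lipschitz_near_continuous (value f g) (X zb) r2 K K0 lip z zr).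
have zbr : `|zb - zb| < r2 by rewrite subrr normr0.
have [fV feasmu] := feas.
have gapb : gap zb <= 0.
  by rewrite /= -subGCP_le0 ?Vfin// -{1}[XY zb]hsubmxK.
have [r3 [mu [r3p mu0 pen]]] :=
  clarke_calm_penalty zb r2 r2p Vfin (cgap zb zbr) gapb calm.
have [Kb Cb] := feasible_comp_set f g H2 C pred0 pred0 zb feasmu
  (fun j => ltac:(by [])) (fun j => ltac:(by [])).
pose r := Num.min (Num.min r1 r3) (r2 / 2).
have rr z : `|z - zb| <= r -> [/\ `|z - zb| <= r1, `|z - zb| <= r3 & `|z - zb| < r2].
  by rewrite !le_min => /andP[/andP[-> ->] zr]; split => //; apply: le_lt_trans zr _; lra.
have rp : 0 < r by rewrite !lt_min r1p r3p divr_gt0.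
have [|||| l0 [lf [lg [nu [l1 [l2 [[l0ge lfge _ sum1] [nl2 cs] stat pcalm]]]]]]] :=
  gcp_fritz_john f g H2 C f2 g2 H2_1 pred0 pred0 (fun z => F (XY z)) gap
   (fun d => dotp (embed_XY (grad F (XY zb))) d) zb r rp cvxC Kb Cb gapb.
- move=> z /rr[_ _ zr]; split; [exact: continuous_XY|exact: cgap].
- move=> z /rr[z1 _ zr] gz Kz Cz.
  have := opt (X z) (Y z) (U z) (rsubmx z); rewrite !quadK !hsubmxK lee_fin.
  apply; first exact: r1P.
  split; last exact: (comp_set_feasible f g H2 C pred0 pred0 z Kz Cz).
  by rewrite hsubmxK subGCP_le0 ?Vfin.
- by move=> d; exact: sderiv_XY.
- move=> d; apply: (gap_lipschitz zb d r2 K r2p K0) => a b ar br.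
  by have [] := lip a b ar br.
have l0p : 0 < l0.
  have := pcalm mu mu0; rewrite lt_def l0ge andbT => H; apply/eqP => l00.
  have : 1 <= l0 * (1 + 4 * mu).
    apply: H => z k c /rr[_ z3 _] kr cr; apply: pen => //.
      by apply: le_trans kr _; rewrite !ge_min lexx !orbT.
    by apply: le_trans cr _; rewrite !ge_min lexx !orbT.
  by rewrite l00 mul0r; lra.
(* Everything in the stationarity condition except the contribution of [V]. *)
pose E := l0 *: embed_XY (grad F (XY zb)) + lf *: embed_XY (grad f (XY zb)) +
  MG zb lg nu l1 l2.
have statE d a : (\forall q \near steps (X zb), V (q.1 + q.2 *: - X d) - V q.1 <= q.2 * a) ->
    0 <= dotp E d + lf * a.
  move=> Va; apply: (@ge0_of_near0 _ _ lf); near=> t.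
  have t0 : 0 < t by near: t; exact: nbhs_right_gt.
  have := stat d _ (gap_increment zb d a t t0 Va).
  move=> /(mulr_ge0 (ltW t0)); congr (0 <= _).
  rewrite /E (dotp_lin2 l0 lf).
  move: (dotp _ d) (dotp _ d) (dotp _ d) => A B D; clear; ring.
pose eta : 'rV[R]_n := X E.
have EE : E = embed_XY (row_mx eta 0).
  (* Along directions with zero [x]-component [V] does not change, so [a = 0] is admissible and all
     other components of [E] must vanish. *)
  have rest (dy : 'rV[R]_m) (du : 'rV[R]_p) (dw : 'rV[R]_l) :
      0 <= dotp (Y E) dy + dotp (U E) du + dotp (rsubmx E) dw.
    have := statE (row_mx (row_mx (row_mx 0 dy) du) dw) 0.
    rewrite !row_mxKl -{1}[E]hsubmxK -{1}[lsubmx E]hsubmxK -{1}[XY E]hsubmxK.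
    rewrite !dotp_row_mx dotp0r add0r mulr0 addr0; apply.
    by apply: steps_all => q; rewrite oppr0 scaler0 addr0 subrr mulr0.
  rewrite -[LHS]hsubmxK -[lsubmx E]hsubmxK -[XY E]hsubmxK /embed_XY -/eta.
  congr (row_mx (row_mx (row_mx _ _) _) _); apply: dotp_ge0_eq0 => d.
  - by have := rest d 0 0; rewrite !dotp0r !addr0.
  - by have := rest 0 d 0; rewrite !dotp0r addr0 add0r.
  - by have := rest 0 0 d; rewrite !dotp0r !add0r.
have eta_le v a : (\forall q \near steps (X zb), V (q.1 + q.2 *: v) - V q.1 <= q.2 * a) ->
    dotp eta v <= lf * a.
  move=> Va; have := statE (row_mx (row_mx (row_mx (- v) 0) 0) 0) a.
  rewrite !row_mxKl opprK EE dotp_embed_XY !row_mxKl dotp_row_mx dotp0r addr0 dotpNr.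
  by move=> /(_ Va); lra.
have ip : 0 < l0^-1 by rewrite invr_gt0.
(* Division by [l0] makes [lf / l0] the parameter [mu]; [t] is chosen so that [l0 *: (grad F + t)]
   together with the multiplier terms gives [E - E = 0]. *)
suff [t tV tE] : exists2 t : 'rV[R]_(n + m),
    value_term f g (lf / l0) (X zb) (Y zb) t &
    l0 *: embed_XY t = lf *: embed_XY (grad f (XY zb)) - E :> 'rV[R]_(n + m + p + l).
  split => //.
  exists (lf / l0), (l0^-1 *: lg), (- (l0^-1 *: nu)), (l0^-1 *: l1), (l0^-1 *: l2).
  split.
  - by rewrite divr_ge0.
  - exists t => //.
    have := stationarity_equation F f g H2 zb t
      (l0^-1 *: lg) (l0^-1 *: nu) (l0^-1 *: l1) (l0^-1 *: l2).
    rewrite quadK /triple !hsubmxK; apply.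
    rewrite multiplier_gradientZ// -[embed_XY _](scalerK (lt0r_neq0 l0p)) -scalerDr.
    have -> : embed_XY (grad F (XY zb) + t) =
        embed_XY (grad F (XY zb)) + embed_XY t :> 'rV[R]_(n + m + p + l).
      by have := embed_XYP (p := p) (l := l) 1 (grad F (XY zb)) t; rewrite !scale1r.
    rewrite (scalerDr l0) tE (_ : _ + _ = 0) ?scaler0//.
    rewrite (addrA (l0 *: embed_XY (grad F (XY zb))) (lf *: _)) (addrAC _ (- E)).
    exact: (subrr E).
  - split.
    + move=> j /andP[]; rewrite hsubmxK => gj _.
      by have [lgj _ _ _ _] := cs j; rewrite mxE lgj ?mulr0.
    + by move=> j /andP[_ uj]; have [_ nuj _ _ _] := cs j; rewrite !mxE nuj// mulr0 oppr0.
    + by rewrite quadK; apply: normal_coneZ => //; exact: ltW.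
  - move=> j _; have [_ _ /(_ isT isT) H _ _] := cs j; rewrite !mxE.
    case: H => [[lgp nun]|lgnu]; [left|right].
      by rewrite mulr_gt0// -mulrN mulr_gt0// oppr_gt0.
    by rewrite mulrN mulrACA lgnu mulr0 oppr0.
(* If [lf = 0], no subgradient is available by division, but the Lipschitz bound [K * |v|] is an
   admissible [a]; it gives [dotp eta v <= 0] for every [v], so [eta = 0]. *)
have [lf0|lfn0] := eqVneq lf 0.
  exists 0; first by left; rewrite lf0 mul0r.
  have eta0 : eta = 0.
    apply/eqP; rewrite -oppr_eq0; apply/eqP/dotp_ge0_eq0 => v.
    rewrite dotpNl oppr_ge0.
    have : dotp eta v <= lf * (K * `|v|).
      apply: eta_le; near=> q.
      have q0 : 0 < q.2 by near: q; exact: steps_gt0.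
      have q1 : `|q.1 - X zb| < r2.
        by near: q; exact: (cvgr_distC_lt _ _ (steps_fst (X zb)) r2 r2p).
      have q2 : `|q.1 + q.2 *: v - X zb| < r2.
        by near: q; exact: (cvgr_distC_lt _ _ (steps_shift (X zb) v) r2 r2p).
      have [_] := lip _ _ q2 q1; rewrite addrAC subrr add0r normrZ (gtr0_norm q0).
      by move=> /(le_trans (ler_norm _)); rewrite mulrCA.
    by rewrite lf0 mul0r.
  rewrite EE eta0 row_mx0 lf0 scale0r /embed_XY !row_mx0 scaler0.
  by rewrite subr0.
have lfp : 0 < lf by rewrite lt_def lfn0.
exists ((lf / l0) *: (grad f (XY zb) - row_mx (lf^-1 *: eta) 0)).
  right; split; first by apply/eqP; rewrite gt_eqF// divr_gt0.
  exists (lf^-1 *: eta); last by rewrite hsubmxK.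
  split => // v; apply: le_clarke_dd => a /eta_le H.
  by rewrite dotpZl mulrC ler_pdivrMr// mulrC.
rewrite EE; apply: dotp_inj => d; rewrite dotpZl dotpBl dotpZl !dotp_embed_XY.
rewrite dotpZl dotpBl -{2 4}[XY d]hsubmxK !dotp_row_mx !dotp0l !addr0 dotpZl.
by field; rewrite lfn0 gt_eqF.
Unshelve. all: by end_near. Qed.

End clarke_calmness.

Theorem mainTheorem4 (R : realType) (n m p l s : nat)
    (F f : 'rV[R]_(n + m) -> R) (g : 'rV[R]_(n + m) -> 'rV[R]_p)
    (H2 : 'rV[R]_(n + m + p + l) -> 'rV[R]_s) (C : set 'rV[R]_s)
    (F_C1 : Ck 1 F) (f_C3 : Ck 3 f) (g_C3 : Ck 3 g) (H2_C1 : Ck 1 H2)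
    (C_neq0 : C !=set0) (C_convex : convex_set C)
    (xb : 'rV[R]_n) (yb : 'rV[R]_m) (ub : 'rV[R]_p) (wb : 'rV[R]_l)
    (zb_opt : local_solution_GCP F f g H2 C xb yb ub wb) :
  (lipschitz_near (value f g) xb ->
   clarke_calm F f g H2 C xb yb ub wb ->
   M_stationary F f g H2 C xb yb ub wb) /\
  (forall mu : R,
   partially_calm_with F f g H2 C mu xb yb ub wb ->
   mu = 0 \/ C1_near (value f g) xb ->
   MPEC_LICQ f g H2 C xb yb ub wb ->
   S_stationary F f g H2 C xb yb ub wb).
Proof.
have f2 := CkW _ f_C3; have g2 := CkW _ g_C3.
have := clarke_calm_M_stationary F f g H2 C F_C1 f2 g2 H2_C1 C_convex
  (quad xb yb ub wb).
have := partially_calm_S_stationary F f g H2 C F_C1 f2 g2 H2_C1 C_convex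
  (quad xb yb ub wb).
rewrite /quad /triple !(row_mxKl, row_mxKr) => partb parta.
split=> [|mu]; first exact: parta.
by apply: partb; case: zb_opt.
Qed.
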